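(* Let $\mathbf{A}\in\mathbb{R}^{n\times n}$ be symmetric positive semidefinite, let $f\in\mathscr{F}$, let $1\le k\le n$, and let $\boldsymbol{\omega}_1,\dots,\boldsymbol{\omega}_k\sim\mathcal{N}(\mathbf{0},\mathbf{I})$ be independent random vectors in $\mathbb{R}^n$. Then the FlexTrace estimator $$\widehat{\mathrm{tr}}_{\mathrm{FT}}=\frac1k\sum_{i=1}^k\left(\operatorname{tr} f(\widehat{\mathbf{A}}_{-i})+\boldsymbol{\omega}_i^\top\big(f(\widehat{\mathbf{A}}_{\mathrm{nys}})-f(\widehat{\mathbf{A}}_{-i})\big)\boldsymbol{\omega}_i\right)$$ of $\operatorname{tr}(f(\mathbf{A}))$ satisfies $$\operatorname{MSE}\left[\widehat{\mathrm{tr}}_{\mathrm{FT}}\right]\le2\,\mathbb{E}\left[\|f(\mathbf{A})-f(\widehat{\mathbf{A}}_{-1})\|_F^2\right]+2\,\mathbb{E}\left[\|f(\mathbf{A})-f(\widehat{\mathbf{A}}_{-1})\|_*^2\right].$$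
   Context: $\mathscr{F}$ is the set of functions $f:[0,\infty)\to[0,\infty)$ with $f(0)=0$ that are operator monotone, i.e. $\mathbf{C}\preceq\mathbf{D}$ implies $f(\mathbf{C})\preceq f(\mathbf{D})$ for symmetric positive semidefinite matrices, where $\preceq$ is the Loewner order. For symmetric positive semidefinite $\mathbf{M}=\mathbf{U}\operatorname{diag}(\mu_i)\mathbf{U}^\top$, $f(\mathbf{M})=\mathbf{U}\operatorname{diag}(f(\mu_i))\mathbf{U}^\top$. $\|\cdot\|_F$ and $\|\cdot\|_*$ are the Frobenius and nuclear norms. For an estimator $\hat\theta$ of $\theta$, $\operatorname{MSE}[\hat\theta]=\mathbb{E}(\theta-\hat\theta)^2$. $\boldsymbol{\Omega}\in\mathbb{R}^{n\times k}$ is the matrix with columns $\boldsymbol{\omega}_1,\dots,\boldsymbol{\omega}_k$. The Nyström approximation of $\mathbf{A}$ with test matrix $\boldsymbol{\Omega}$ is $\widehat{\mathbf{A}}_{\mathrm{nys}}=\mathbf{A}\boldsymbol{\Omega}(\boldsymbol{\Omega}^\top\mathbf{A}\boldsymbol{\Omega})^\dagger(\mathbf{A}\boldsymbol{\Omega})^\top$, with $\dagger$ the Moore–Penrose pseudoinverse. $\widehat{\mathbf{A}}_{-i}$ is the Nyström approximation of $\mathbf{A}$ whose test matrix is $\boldsymbol{\Omega}$ with its $i$-th column removed (an empty test matrix gives the zero matrix). *)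

(* Defs.v *)
From HB Require Import structures.
From mathcomp Require Import all_boot all_order all_algebra.
From mathcomp Require Import all_classical all_reals all_analysis.
Set Implicit Arguments. Unset Strict Implicit. Unset Printing Implicit Defensive.
Import Order.TTheory GRing.Theory Num.Theory.
Local Open Scope classical_set_scope.
Local Open Scope ring_scope.

Definition quad_form (R : realType) (n : nat) (M : 'M[R]_n) (x : 'cV[R]_n) : R :=
  (x^T *m M *m x) ord0 ord0.

Definition psdmx (R : realType) (n : nat) (M : 'M[R]_n) : Prop :=
  M^T = M /\ forall x : 'cV[R]_n, 0 <= quad_form M x.

Definition loewner_le (R : realType) (n : nat) (C D : 'M[R]_n) : Prop :=
  psdmx (D - C).

Definition is_funmx (R : realType) (f : R -> R) (n : nat) (M N : 'M[R]_n) : Prop :=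
  exists (U : 'M[R]_n) (mu : 'rV[R]_n),
    [/\ U *m U^T = 1%:M,
        M = U *m diag_mx mu *m U^T
      & N = U *m diag_mx (map_mx f mu) *m U^T].

(* Every real symmetric M admits such an N, and N does not depend on the chosen
   eigendecomposition; 0 is a junk value, taken when M is not symmetric. *)
Definition funmx (R : realType) (f : R -> R) (n : nat) (M : 'M[R]_n) : 'M[R]_n :=
  xget 0 [set N | is_funmx f M N].

(* f stands for a function on [0, +oo[: its values at negative reals are
   unconstrained, and irrelevant since the matrices involved are psd. *)
Definition operator_monotone (R : realType) (f : R -> R) : Prop :=
  forall (m : nat) (C D : 'M[R]_m), psdmx C -> psdmx D ->
    loewner_le C D -> loewner_le (funmx f C) (funmx f D).

Definition in_scrF (R : realType) (f : R -> R) : Prop :=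
  [/\ forall x, 0 <= x -> 0 <= f x, f 0 = 0 & operator_monotone f].

Definition frob_norm (R : realType) (m n : nat) (M : 'M[R]_(m, n)) : R :=
  Num.sqrt (\sum_(i < m) \sum_(j < n) M i j ^+ 2).

(* The trace of the square root of M^T M is the sum of the singular values
   of M, i.e. of the square roots of the eigenvalues of M^T M. *)
Definition nuclear_norm (R : realType) (m n : nat) (M : 'M[R]_(m, n)) : R :=
  \tr (funmx Num.sqrt (M^T *m M)).

Definition is_moore_penrose (R : realType) (m n : nat)
    (M : 'M[R]_(m, n)) (X : 'M[R]_(n, m)) : Prop :=
  [/\ M *m X *m M = M, X *m M *m X = X,
      (M *m X)^T = M *m X & (X *m M)^T = X *m M].

(* The set below is always a singleton. MathComp's pinvmx is only a one-sided
   generalized inverse, not the Moore-Penrose one. *)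
Definition moore_penrose (R : realType) (m n : nat)
    (M : 'M[R]_(m, n)) : 'M[R]_(n, m) :=
  xget 0 [set X | is_moore_penrose M X].

(* For l = 0 the product factors through 'M_0, so the result is 0. *)
Definition nystrom (R : realType) (n l : nat)
    (A : 'M[R]_n) (Omega : 'M[R]_(n, l)) : 'M[R]_n :=
  A *m Omega *m moore_penrose (Omega^T *m A *m Omega) *m (A *m Omega)^T.

Definition nystrom_drop (R : realType) (n k : nat)
    (A : 'M[R]_n) (Omega : 'M[R]_(n, k)) (i : 'I_k) : 'M[R]_n :=
  nystrom A (col' i Omega).

Definition flextrace (R : realType) (f : R -> R) (n k : nat)
    (A : 'M[R]_n) (Omega : 'M[R]_(n, k)) : R :=
  k%:R^-1 * \sum_(i < k)
    (\tr (funmx f (nystrom_drop A Omega i))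
     + quad_form (funmx f (nystrom A Omega) - funmx f (nystrom_drop A Omega i))
                 (col i Omega)).

(* Random vectors take values in n.-tuple R, which (unlike 'cV[R]_n) carries a
   sigma-algebra in the library, the product of the Borel ones.
   N(0, I) is the product measure of n copies of N(0, 1), determined by its
   values on measurable rectangles. *)
Definition std_gaussian_vector (R : realType) (d : measure_display)
    (T : measurableType d) (P : probability T R) (n : nat)
    (X : {RV P >-> n.-tuple R}) : Prop :=
  forall B : 'I_n -> set R, (forall j, measurable (B j)) ->
    distribution P X [set t | forall j, B j (tnth t j)] =
    (\prod_(j < n) normal_prob (0 : R) 1 (B j))%E.

Definition independent_RVs (R : realType) (d d' : measure_display)
    (T : measurableType d) (T' : measurableType d') (P : probability T R)
    (I : finType) (X : I -> {RV P >-> T'}) : Prop :=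
  forall (J : {set I}) (B : I -> set T'), (forall i, measurable (B i)) ->
    P [set w | forall i, i \in J -> B i (X i w)] =
    (\prod_(i in J) P (X i @^-1` B i))%E.

Definition test_matrix (R : realType) (d : measure_display)
    (T : measurableType d) (P : probability T R) (n k : nat)
    (omega : 'I_k -> {RV P >-> n.-tuple R}) (w : T) : 'M[R]_(n, k) :=
  \matrix_(i < n, j < k) tnth (omega j w) i.

Definition MSE (R : realType) (d : measure_display) (T : measurableType d)
    (P : probability T R) (theta : R) (est : T -> R) : \bar R :=
  'E_P[fun w => ((theta - est w) ^+ 2)%R]%E.

(* Main.v *)
(* Let D_i = f(A) - f(A_{-i}) and let N be the full Nystrom approximation. Since
   A_{-i} <= N <= A in the Loewner order, operator monotonicity puts
   z_i = w_i^T (f(N) - f(A_{-i})) w_i in [0, q_i], where q_i = w_i^T D_i w_i.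
   The error of the estimator is the mean over i of t_i - z_i, with t_i = tr D_i,
   and convexity gives (t_i - z_i)^2 <= (q_i - t_i)^2 + t_i^2. As D_i only depends
   on the columns other than w_i, integrating w_i first yields
   E (q_i - t_i)^2 = 2 E |D_i|_F^2, while t_i is the nuclear norm of the psd
   matrix D_i. Jensen's inequality over i and exchangeability then give the bound
   2 E |D_1|_F^2 + E |D_1|_*^2, which is slightly better than the claim. *)
Require Import Defs.
From HB Require Import structures.
From mathcomp Require Import all_boot all_order all_algebra.
From mathcomp Require Import complex ring lra.
From mathcomp Require Import all_classical all_reals all_analysis.
From mathcomp Require Import measurable_realfun.
Import Order.TTheory GRing.Theory Num.Theory.
Import numFieldNormedType.Exports.
Set Implicit Arguments. Unset Strict Implicit. Unset Printing Implicit Defensive.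
Local Open Scope ring_scope.

(** * Real spectral theorem *)

(** The full approximation N makes z_i depend on w_i in a nonlinear way. Convexity trades z_i for
    its extreme values 0 and q_i, which involve w_i only through a quadratic form whose matrix is a
    function of the other columns; this is what allows w_i to be integrated out exactly. The factor
    2 of the Frobenius term is the variance of s^2 for a standard Gaussian s on the diagonal, and
    comes from the two equal entries of a symmetric matrix off it. The main obstacle is
    measurability: Nystrom approximations may jump where the rank of the test matrix changes, f may
    jump at 0, and eigenvectors cannot be followed continuously. Hence M |-> g(M) is treated for
    Borel g without selecting eigenvalues or eigenvectors. Expectations are integrals of nonnegative
    functions with values in [0, +oo], so the bound is compared there without first proving its
    terms finite. *)

(** The complexification [B] is Hermitian, so its eigenvalues are real. Its characteristic
    polynomial is the image of that of [A], which therefore has the real root [a] as well. *)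
Lemma symmetric_eigenvector (R : rcfType) n (A : 'M[R]_n.+1) : A^T = A ->
  exists (a : R) (u : 'cV[R]_n.+1), A *m u = a *: u /\ u != 0.
Proof.
move=> sA; pose B := map_mx (real_complex R) A.
have sB : B \is symmetricmx.
  by apply/is_hermitianmxP; rewrite expr0 scale1r /B map_mx_id// map_trmx sA.
have rB : B \is a realmx by apply/mxOverP => i j; rewrite mxE complex_real.
have hB := realsym_hermsym sB rB.
have /orthomx_spectralP := hermitian_normalmx hB.
have /mxOverP/(_ ord0 ord0)/complex_realP [a Ha] := hermitian_spectral_diag_real hB.
set Q := spectralmx B; set sp := spectral_diag B in Ha * => BE.
have Qu : Q \in unitmx by exact: spectral_unit.
have : eigenvalue B (real_complex R a).
  apply/eigenvalueP; exists (row ord0 Q).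
    rewrite -row_mul {1}BE !mulmxA mulmxV// mul1mx row_mul row_diag_mx -Ha.
    by rewrite -scalemxAl -rowE.
  apply/eqP => Q0.
  have : row ord0 Q *m invmx Q = 0 by rewrite Q0 mul0mx.
  rewrite -row_mul mulmxV// => /rowP/(_ ord0); rewrite !mxE eqxx => /eqP.
  by rewrite oner_eq0.
rewrite eigenvalue_root_char /B -map_char_poly fmorph_root -eigenvalue_root_char.
case/eigenvalueP => v vA v0; exists a, v^T; split; last by rewrite trmx_eq0.
by rewrite -[A]sA -trmx_mul vA linearZ.
Qed.

Lemma dot_delta (R : comPzRingType) n (u : 'cV[R]_n) i : (u^T *m delta_mx i ord0) = (u i ord0)%:M.
Proof. by apply/rowP => j; rewrite !ord1 -colE !mxE. Qed.

Lemma dot_self_ge0 (R : realDomainType) n (u : 'cV[R]_n) : 0 <= (u^T *m u) ord0 ord0.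
Proof. by rewrite mxE; apply: sumr_ge0 => i _; rewrite mxE -expr2 sqr_ge0. Qed.

Lemma dot_self_eq0 (R : realDomainType) n (u : 'cV[R]_n) :
  (u^T *m u) ord0 ord0 = 0 -> u = 0.
Proof.
rewrite mxE => uu0; apply/colP => i.
have /(_ i isT)/eqP : forall j, true -> u^T ord0 j * u j ord0 = 0.
  by apply: psumr_eq0P => // j _; rewrite mxE -expr2 sqr_ge0.
by rewrite !mxE -expr2 sqrf_eq0 => /eqP.
Qed.

(* Householder reflection exchanging e_0 and u. *)
Lemma orthogonal_first_col (R : rcfType) n (u : 'cV[R]_n.+1) : u^T *m u = 1%:M ->
  exists H : 'M[R]_n.+1, H *m H^T = 1%:M /\ H *m delta_mx ord0 ord0 = u.
Proof.
move=> uu; pose e : 'cV[R]_n.+1 := delta_mx ord0 ord0; pose w := u - e.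
have [w0|w0] := eqVneq w 0.
  exists 1%:M; rewrite trmx1 mulmx1 mul1mx; split => //.
  by apply/esym/eqP; rewrite -subr_eq0 -/e -/w w0.
have ue : u^T *m e = (u ord0 ord0)%:M by exact: dot_delta.
have ee : e^T *m e = 1%:M by rewrite dot_delta mxE !eqxx.
have eu : e^T *m u = (u ord0 ord0)%:M by rewrite -[LHS]trmxK trmx_mul trmxK ue tr_scalar_mx.
have we : w^T *m e = (u ord0 ord0 - 1)%:M.
  by rewrite /w linearB/= mulmxBl ue ee -rmorphB.
have ww : w^T *m w = (2 * (1 - u ord0 ord0))%:M.
  rewrite {2}/w mulmxBr we /w linearB/= mulmxBl uu eu -!rmorphB/=.
  by congr (_%:M); ring.
(* Half of the squared norm of [w], so that [H] is the usual reflection I - 2 w w^T / |w|^2. *)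
pose c := 1 - u ord0 ord0.
have c0 : c != 0.
  apply: contra_neq w0 => c0; apply: dot_self_eq0.
  by rewrite ww mxE /= -/c c0 mulr0 mul0rn.
pose H := 1%:M - c^-1 *: (w *m w^T).
have HT : H^T = H by rewrite /H linearB/= linearZ/= trmx1 trmx_mul trmxK.
exists H; split.
  rewrite HT /H mulmxBl mul1mx mulmxBr mulmx1.
  rewrite -scalemxAr -!scalemxAl mulmxA -[w *m w^T *m w]mulmxA ww mul_mx_scalar.
  rewrite -!scalemxAl !scalerA -/c -scalerBl -addrA -opprD -scalerDl.
  by rewrite (_ : c^-1 + _ = 0) ?scale0r ?subr0//; field.
rewrite /H mulmxBl mul1mx -scalemxAl -mulmxA we mul_mx_scalar scalerA.
rewrite (_ : _ * _ = -1); last by rewrite /c in c0 *; field.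
by rewrite scaleN1r opprK /w addrC subrK.
Qed.

(** Deflation: in an orthonormal basis starting with a unit eigenvector the first column is a
    multiple of e_0, by symmetry so is the first row, and induction applies to the remaining
    block. *)
Lemma symmetric_spectral (R : rcfType) n (A : 'M[R]_n) : A^T = A ->
  exists (U : 'M[R]_n) (mu : 'rV[R]_n),
    U *m U^T = 1%:M /\ A = U *m diag_mx mu *m U^T.
Proof.
elim: n A => [|n IHn] A sA.
  by exists 1%:M, 0; split; apply/matrixP => - [].
have [a [u0 [Au0 u00]]] := symmetric_eigenvector sA.
have [s s0 us] : exists2 s, s != 0 & u0^T *m u0 = (s ^+ 2)%:M.
  exists (Num.sqrt ((u0^T *m u0) ord0 ord0)).
    rewrite sqrtr_eq0 -ltNge lt_def dot_self_ge0 andbT.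
    by apply: contra_neq u00 => /dot_self_eq0.
  by rewrite sqr_sqrtr ?dot_self_ge0// -mx11_scalar.
pose u := s^-1 *: u0.
have uu : u^T *m u = 1%:M.
  rewrite /u [(_ *: _)^T]linearZ -scalemxAl -scalemxAr us !scale_scalar_mx.
  by congr (_%:M); field.
have Au : A *m u = a *: u by rewrite /u -scalemxAr Au0 !scalerA mulrC.
have [H [HH He]] := orthogonal_first_col uu.
have HH' : H^T *m H = 1%:M by apply: mulmx1C.
pose A' : 'M[R]_(1 + n) := H^T *m A *m H.
have sA' : A'^T = A' by rewrite /A' !trmx_mul trmxK sA mulmxA.
have A'def : A' = H^T *m A *m H by [].
have A'e : H^T *m A *m H *m delta_mx ord0 ord0 = a *: delta_mx ord0 ord0 :> 'cV[R]_n.+1.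
  by rewrite -[X in X = _]mulmxA He -mulmxA Au -scalemxAr -He mulmxA HH' mul1mx.
have sD : (drsubmx A')^T = drsubmx A' by rewrite trmx_drsub sA'.
have [V [nu [VV Dd]]] := IHn _ sD.
rewrite -A'def in A'e; clearbody A'.
have A'E : A' = block_mx a%:M 0 0 (drsubmx A').
  have col0 i : A' i ord0 = if i == ord0 then a else 0.
    have /colP/(_ i) := A'e; rewrite -colE !mxE !eqxx andbT => ->.
    by case: eqP => _ /=; rewrite ?mulr1 ?mulr0.
  have l0 (j : 'I_1) : lshift n j = ord0 :> 'I_(1 + n).
    by apply: val_inj; rewrite /= ord1.
  have row0 i : A' ord0 i = if i == ord0 then a else 0.
    by rewrite -col0 -[in LHS]sA' mxE.
  rewrite -{1}[A']submxK; congr block_mx; apply/matrixP => i j.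
  - by rewrite !mxE !l0 col0 eqxx !ord1 eqxx mulr1n.
  - by rewrite !mxE l0 row0 -val_eqE.
  - by rewrite !mxE l0 col0 -val_eqE.
pose W : 'M[R]_(1 + n) := block_mx 1%:M 0 0 V.
have WW : W *m W^T = 1%:M.
  rewrite /W tr_block_mx mulmx_block !trmx0 !trmx1 !mul1mx !mulmx0 !mul0mx VV.
  by rewrite !addr0 add0r -scalar_mx_block.
have A'W : A' = W *m diag_mx (row_mx a%:M nu) *m W^T.
  rewrite A'E Dd /W tr_block_mx diag_mx_row !mulmx_block.
  rewrite !trmx0 !trmx1 !mul1mx !mulmx0 !mul0mx !addr0 !add0r !mulmx1.
  by congr block_mx; rewrite ?mul0mx//; apply/matrixP => i j; rewrite !ord1 !mxE.
exists (H *m (W : 'M[R]_n.+1)), (row_mx a%:M nu); split.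
  by rewrite trmx_mul mulmxA -[H *m _ *m _]mulmxA WW mulmx1 HH.
rewrite trmx_mul -[LHS]mul1mx -[LHS]mulmx1 -HH.
rewrite !mulmxA -[H *m W *m _]mulmxA -[H *m (W *m _) *m _]mulmxA.
by rewrite -A'W A'def !mulmxA.
Qed.

(** * Functional calculus and Loewner order of Nystrom approximations *)

Section MatrixFunctions.
Variable R : realType.
Implicit Types f g : R -> R.

(** Two eigendecompositions are intertwined by [Z], whose entry (i, j) vanishes unless the
    eigenvalues [xi] i and [nu] j coincide. Hence [Z] also intertwines their images under [f]. *)
Lemma funmx_spectral f n (U : 'M[R]_n) (mu : 'rV[R]_n) : U *m U^T = 1%:M ->
  funmx f (U *m diag_mx mu *m U^T) = U *m diag_mx (map_mx f mu) *m U^T.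
Proof.
move=> UU; have UU' := mulmx1C UU.
apply: xget_subset1; first by exists U, mu.
move=> _ _ [V [nu [VV MV ->]]] [W [xi [WW MW ->]]].
have VV' := mulmx1C VV; have WW' := mulmx1C WW.
pose Z := W^T *m V.
have comm : Z *m diag_mx nu = diag_mx xi *m Z.
  have := congr1 (fun M => W^T *m M *m V) (etrans (esym MV) MW).
  rewrite !mulmxA WW' mul1mx -[_ *m V^T *m V]mulmxA VV' mulmx1 => ->.
  by rewrite -mulmxA.
have commf : Z *m diag_mx (map_mx f nu) = diag_mx (map_mx f xi) *m Z.
  apply/matrixP => i j; have /matrixP/(_ i j) := comm.
  rewrite mul_mx_diag mul_diag_mx mul_mx_diag mul_diag_mx !mxE => e.
  have [->|] := eqVneq (nu ord0 j) (xi ord0 i); first by rewrite mulrC.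
  move=> ne; suff -> : \sum_j0 W^T i j0 * V j0 j = 0 by rewrite mul0r mulr0.
  apply/eqP; move/eqP: e; rewrite mulrC -subr_eq0 -mulrBl mulf_eq0 subr_eq0.
  by rewrite (negPf ne).
have WZ : W *m Z = V by rewrite mulmxA WW mul1mx.
have ZV : Z *m V^T = W^T by rewrite -mulmxA VV mulmx1.
rewrite -{1}WZ; clearbody Z.
by rewrite -[W *m Z *m _]mulmxA commf -!mulmxA ZV.
Qed.

Lemma eq_funmx f g n (M : 'M[R]_n) : f =1 g -> funmx f M = funmx g M.
Proof. by move=> /funext ->. Qed.

Lemma mul_conjmx n (U D E : 'M[R]_n) : U *m U^T = 1%:M ->
  U *m D *m U^T *m (U *m E *m U^T) = U *m (D *m E) *m U^T.
Proof.
move=> /mulmx1C UU.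
by rewrite !mulmxA -[U *m D *m U^T *m U]mulmxA UU mulmx1.
Qed.

Lemma funmx_tr f n (M : 'M[R]_n) : M^T = M -> (funmx f M)^T = funmx f M.
Proof.
move=> /symmetric_spectral[U [mu [UU ->]]].
by rewrite funmx_spectral// !trmx_mul trmxK tr_diag_mx mulmxA.
Qed.

Lemma funmx_cst c n (M : 'M[R]_n) : M^T = M -> funmx (fun=> c) M = c%:M.
Proof.
move=> /symmetric_spectral[U [mu [UU ->]]]; rewrite funmx_spectral//.
rewrite (_ : map_mx _ _ = const_mx c); last by apply/rowP => i; rewrite !mxE.
by rewrite diag_const_mx mul_mx_scalar -scalemxAl UU scalemx1.
Qed.

Lemma funmx_id n (M : 'M[R]_n) : M^T = M -> funmx id M = M.
Proof.
by move=> /symmetric_spectral[U [mu [UU ->]]]; rewrite funmx_spectral// map_mx_id.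
Qed.

Lemma funmxD f g n (M : 'M[R]_n) : M^T = M ->
  funmx (fun x => f x + g x) M = funmx f M + funmx g M.
Proof.
move=> /symmetric_spectral[U [mu [UU ->]]]; rewrite !funmx_spectral//.
rewrite -mulmxDl -mulmxDr -raddfD/=; congr (_ *m diag_mx _ *m _).
by apply/rowP => i; rewrite !mxE.
Qed.

Lemma funmxM f g n (M : 'M[R]_n) : M^T = M ->
  funmx (fun x => f x * g x) M = funmx f M *m funmx g M.
Proof.
move=> /symmetric_spectral[U [mu [UU ->]]]; rewrite !funmx_spectral//.
rewrite mul_conjmx// mulmx_diag; congr (_ *m diag_mx _ *m _).
by apply/rowP => i; rewrite !mxE.
Qed.

Lemma funmxV f n (M : 'M[R]_n) : M^T = M -> (forall x, f x != 0) ->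
  funmx (fun x => (f x)^-1) M = invmx (funmx f M).
Proof.
move=> sM f0; have e : funmx f M *m funmx (fun x => (f x)^-1) M = 1%:M.
  rewrite -funmxM// -[RHS](funmx_cst 1 sM). apply: eq_funmx => x.
  by rewrite mulfV.
by rewrite -[RHS]mulmx1 -e mulKmx//; case/mulmx1_unit: e.
Qed.

(** For fixed [M] an entry is a finite sum over the eigenvalues, so pointwise convergence of the
    functions is enough. *)
Lemma funmx_cvg (g_ : nat -> R -> R) g n (M : 'M[R]_n) i j : M^T = M ->
  (forall x, (g_ ^~ x @ \oo --> g x)%classic) ->
  ((fun m => funmx (g_ m) M i j) @ \oo --> funmx g M i j)%classic.
Proof.
move=> /symmetric_spectral[U [mu [UU ->]]] cg.
have E h : funmx h (U *m diag_mx mu *m U^T) i j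
    = \sum_l U i l * h (mu ord0 l) * U j l.
  rewrite funmx_spectral// mxE; apply: eq_bigr => l _.
  by rewrite mul_mx_diag !mxE.
rewrite E; under eq_fun do rewrite E.
apply: cvg_big => [|l _]; first exact: add_continuous.
by apply: cvgM; [apply: cvgM; [exact: cvg_cst|exact: cg]|exact: cvg_cst].
Qed.

Lemma psd_spectral n (M : 'M[R]_n) : psdmx M ->
  exists (U : 'M[R]_n) (mu : 'rV[R]_n), [/\ U *m U^T = 1%:M,
    M = U *m diag_mx mu *m U^T & forall i, 0 <= mu ord0 i].
Proof.
move=> [/symmetric_spectral[U [mu [UU ME]]] pM]; exists U, mu; split => // i.
have := pM (U *m delta_mx i ord0); rewrite /quad_form ME trmx_mul !mulmxA.
rewrite -[_ *m U^T *m U]mulmxA (mulmx1C UU) mulmx1.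
rewrite -[_ *m U^T *m U]mulmxA (mulmx1C UU) mulmx1.
by rewrite -colE trmx_delta -rowE !mxE eqxx.
Qed.

Lemma psd_gram m n (X : 'M[R]_(m, n)) : psdmx (X *m X^T).
Proof.
split; first by rewrite trmx_mul trmxK.
move=> x; rewrite /quad_form !mulmxA -[_ *m X^T *m x]mulmxA.
by rewrite -[x^T *m X]trmxK trmx_mul trmxK dot_self_ge0.
Qed.

Lemma psd_conj m n (X : 'M[R]_(m, n)) (M : 'M[R]_n) : psdmx M -> psdmx (X *m M *m X^T).
Proof.
move=> [sM pM]; split; first by rewrite !trmx_mul trmxK sM mulmxA.
move=> x; have := pM (X^T *m x); rewrite /quad_form trmx_mul trmxK.
by rewrite !mulmxA.
Qed.

Lemma psd_diag n (mu : 'rV[R]_n) : (forall i, 0 <= mu ord0 i) -> psdmx (diag_mx mu).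
Proof.
move=> mu0; split; first by rewrite tr_diag_mx.
move=> x; rewrite /quad_form mxE; apply: sumr_ge0 => i _.
by rewrite mul_mx_diag !mxE mulrAC mulr_ge0// -expr2 sqr_ge0.
Qed.

Lemma eq_funmx_psd f g n (M : 'M[R]_n) : psdmx M -> (forall x, 0 <= x -> f x = g x) ->
  funmx f M = funmx g M.
Proof.
move=> /psd_spectral[U [mu [UU -> mu0]]] fg; rewrite !funmx_spectral//.
by congr (_ *m diag_mx _ *m _); apply/rowP => i; rewrite !mxE fg.
Qed.

Lemma psd_trace_ge0 n (M : 'M[R]_n) : psdmx M -> 0 <= \tr M.
Proof.
move=> [_ pM]; apply: sumr_ge0 => i _; have := pM (delta_mx i ord0).
by rewrite /quad_form -mulmxA -colE trmx_delta -rowE !mxE.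
Qed.

Lemma psd_idempotent n (Q : 'M[R]_n) : Q^T = Q -> Q *m Q = Q -> psdmx Q.
Proof. by move=> sQ iQ; have := psd_gram Q; rewrite sQ iQ. Qed.

Lemma nuclear_norm_psd n (M : 'M[R]_n) : psdmx M -> nuclear_norm M = \tr M.
Proof.
move=> pM; rewrite /nuclear_norm; congr (\tr _).
have [sM _] := pM; rewrite sM.
have /psd_spectral[U [mu [UU ME mu0]]] := pM.
rewrite {1 2}ME mul_conjmx// mulmx_diag funmx_spectral// ME.
congr (_ *m diag_mx _ *m _); apply/rowP => i.
by rewrite !mxE -expr2 sqrtr_sqr ger0_norm.
Qed.

Lemma quad_formB n (M N : 'M[R]_n) x : quad_form (M - N) x = quad_form M x - quad_form N x.
Proof. by rewrite /quad_form mulmxBr mulmxBl !mxE. Qed.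

Lemma moore_penroseP n (M : 'M[R]_n) : M^T = M -> is_moore_penrose M (moore_penrose M).
Proof.
move=> sM; apply: (@xgetPex _ 0 [set X | is_moore_penrose M X]%classic).
(* Since 0^-1 = 0, this inverts the nonzero eigenvalues and keeps the zero ones. *)
exists (funmx GRing.inv M).
have ifE : M *m funmx GRing.inv M = funmx (fun x => x * x^-1) M.
  by rewrite [RHS]funmxM// funmx_id.
have fiE : funmx GRing.inv M *m M = funmx (fun x => x * x^-1) M.
  rewrite -{2}[M]funmx_id// -funmxM//; apply: eq_funmx => x.
  by rewrite mulrC.
split; rewrite ?ifE ?fiE ?funmx_tr//.
  rewrite -{2 3}[M]funmx_id// -funmxM//; apply: eq_funmx => x.
  by have [->|x0] := eqVneq x 0; rewrite ?mulr0// mulfV// mul1r.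
rewrite -funmxM//; apply: eq_funmx => x.
by have [->|x0] := eqVneq x 0; rewrite ?invr0 ?mulr0// mulfV// mul1r.
Qed.

(* Orthogonal projector onto the column space of X, which is that of X X^T;
   writing it as a function of X X^T makes it measurable in X. *)
Definition range_proj m n (X : 'M[R]_(m, n)) : 'M[R]_m :=
  funmx (fun x => (x != 0)%:R) (X *m X^T).

Lemma range_proj_tr m n (X : 'M[R]_(m, n)) : (range_proj X)^T = range_proj X.
Proof. by apply: funmx_tr; case: (psd_gram X). Qed.

Lemma range_proj_idem m n (X : 'M[R]_(m, n)) : range_proj X *m range_proj X = range_proj X.
Proof.
have [sH _] := psd_gram X; rewrite -funmxM//; apply: eq_funmx => x.
  by case: (x == 0); rewrite ?mulr0 ?mulr1.
Qed.

(** With [X] factored out on the left, any matrix that fixes [X] also fixes the projector. *)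
Lemma range_projE m n (X : 'M[R]_(m, n)) :
  range_proj X = X *m (X^T *m funmx GRing.inv (X *m X^T)).
Proof.
have [sH _] := psd_gram X.
rewrite mulmxA -{1}(funmx_id sH) -funmxM//; apply: eq_funmx => x.
by have [->|x0] := eqVneq x 0; rewrite ?mul0r// mulfV.
Qed.

Lemma gram_eq0 m n (X : 'M[R]_(m, n)) : X *m X^T = 0 -> X = 0.
Proof.
move=> X0; apply: trmx_inj; rewrite trmx0; apply/matrixP => i j.
have : (col j X^T)^T *m col j X^T = 0.
  by rewrite colE trmx_mul trmxK -!mulmxA [X *m (_ *m _)]mulmxA X0 mul0mx mulmx0.
move=> /(congr1 (fun M : 'M[R]_1 => M ord0 ord0)); rewrite [RHS]mxE.
by move=> /dot_self_eq0/colP/(_ i); rewrite !mxE.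
Qed.

(** X^T X and X have the same kernel, so X^T can be cancelled. *)
Lemma gram_inj m n p (X : 'M[R]_(m, n)) (Y Z : 'M[R]_(n, p)) :
  X^T *m X *m Y = X^T *m X *m Z -> X *m Y = X *m Z.
Proof.
move=> YZ; apply/eqP; rewrite -subr_eq0 -mulmxBr; apply/eqP; apply: trmx_inj.
rewrite trmx0; apply: gram_eq0; rewrite trmxK trmx_mul -mulmxA.
by rewrite [X^T *m _]mulmxA mulmxBr YZ subrr mulmx0.
Qed.

(** The projector Q fixes X X^T, hence (Q X - X) (Q X - X)^T = 0. *)
Lemma range_proj_id m n (X : 'M[R]_(m, n)) : range_proj X *m X = X.
Proof.
have [sH _] := psd_gram X.
have QH : range_proj X *m (X *m X^T) = X *m X^T.
  rewrite -[X in _ *m X = _](funmx_id sH) -funmxM// -[RHS](funmx_id sH); apply: eq_funmx => x.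
  by have [->|x0] := eqVneq x 0; rewrite ?mulr0// mul1r.
apply/eqP; rewrite -subr_eq0; apply/eqP; apply: gram_eq0.
rewrite linearB/= trmx_mul range_proj_tr mulmxBl !mulmxBr.
by rewrite !mulmxA -[_ *m X *m X^T]mulmxA QH subrr.
Qed.

(** Put P = X K and let Q be the projector. The columns of both lie in the range of X, so P Q = Q
    and Q P = P; transposing the first equality gives Q P = Q. *)
Lemma range_proj_unique m n (X : 'M[R]_(m, n)) (K : 'M[R]_(n, m)) :
  X *m K *m X = X -> (X *m K)^T = X *m K -> X *m K = range_proj X.
Proof.
move=> XKX sK.
have PK : X *m K *m range_proj X = range_proj X.
  by rewrite range_projE mulmxA XKX.
rewrite -{1}[X]range_proj_id -[_ *m X *m K]mulmxA.
by rewrite -[LHS]trmxK trmx_mul sK range_proj_tr PK range_proj_tr.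
Qed.

Lemma gram_range_proj n l (X : 'M[R]_(n, l)) :
  X *m moore_penrose (X^T *m X) *m X^T = range_proj X.
Proof.
set K := moore_penrose _.
have [GKG _ _ _] : is_moore_penrose (X^T *m X) K.
  by apply: moore_penroseP; rewrite trmx_mul trmxK.
have XKX : X *m (K *m X^T *m X) = X.
  by rewrite -[RHS]mulmx1; apply: gram_inj; rewrite mulmx1 -[RHS]GKG !mulmxA.
have XKTX : X *m (K^T *m X^T *m X) = X.
  rewrite -[RHS]mulmx1; apply: gram_inj; rewrite mulmx1.
  by have := congr1 trmx GKG; rewrite !trmx_mul !trmxK !mulmxA.
(* Symmetry of P = X K X^T is read off from P^T P = P, without showing that K is symmetric. *)
have sP : (X *m (K *m X^T))^T = X *m (K *m X^T).
  have PTP : (X *m (K *m X^T))^T *m (X *m (K *m X^T)) = X *m (K *m X^T).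
    rewrite !trmx_mul trmxK.
    by move: XKTX; rewrite !mulmxA => ->.
  by rewrite -{1}PTP trmx_mul trmxK.
by rewrite -(range_proj_unique _ sP) -mulmxA.
Qed.

(** With X = B W, W^T A W = X^T X and A W = B X. Loewner comparisons of Nystrom approximations thus
    reduce to comparisons of projectors. *)
Lemma nystromE n l (A B : 'M[R]_n) (W : 'M[R]_(n, l)) :
  B^T = B -> A = B *m B -> nystrom A W = B *m range_proj (B *m W) *m B.
Proof.
by move=> sB AE; rewrite -gram_range_proj /nystrom AE !trmx_mul sB !mulmxA.
Qed.

Lemma psd_mulmx_sym n (B M : 'M[R]_n) : B^T = B -> psdmx M -> psdmx (B *m M *m B).
Proof. by move=> sB pM; rewrite -{2}sB; exact: psd_conj. Qed.

Lemma psd_range_proj m n (X : 'M[R]_(m, n)) : psdmx (range_proj X).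
Proof. exact: psd_idempotent (range_proj_tr X) (range_proj_idem X). Qed.

Lemma psd_range_proj_compl m n (X : 'M[R]_(m, n)) : psdmx (1%:M - range_proj X).
Proof.
apply: psd_idempotent; first by rewrite linearB/= trmx1 range_proj_tr.
by rewrite mulmxBl mul1mx mulmxBr mulmx1 range_proj_idem subrr subr0.
Qed.

(** Both products of the two projectors equal the smaller one, so their difference is again a
    symmetric idempotent. *)
Lemma range_proj_le m n p (X : 'M[R]_(m, n)) (Y : 'M[R]_(m, p)) :
  range_proj X *m Y = Y -> psdmx (range_proj X - range_proj Y).
Proof.
move=> XY; have PQ : range_proj X *m range_proj Y = range_proj Y.
  by rewrite [range_proj Y]range_projE mulmxA XY.
have QP : range_proj Y *m range_proj X = range_proj Y.
  by rewrite -[LHS]trmxK trmx_mul !range_proj_tr PQ range_proj_tr.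
apply: psd_idempotent; first by rewrite linearB/= !range_proj_tr.
rewrite mulmxBl !mulmxBr QP PQ !range_proj_idem.
by rewrite subrr subr0.
Qed.

Lemma psd_sqrt n (A : 'M[R]_n) : psdmx A ->
  exists B : 'M[R]_n, B^T = B /\ A = B *m B.
Proof.
move=> pA; have [sA _] := pA; exists (funmx Num.sqrt A).
split; first exact: funmx_tr.
rewrite -funmxM// -[LHS](funmx_id sA); apply: eq_funmx_psd => // x x0.
by rewrite -expr2 sqr_sqrtr.
Qed.

Lemma psd_nystrom n l (A : 'M[R]_n) (W : 'M[R]_(n, l)) :
  psdmx A -> psdmx (nystrom A W).
Proof.
move=> /psd_sqrt[B [sB AE]]; rewrite (nystromE _ sB AE).
exact/psd_mulmx_sym/psd_range_proj.
Qed.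

Lemma nystrom_le n l (A : 'M[R]_n) (W : 'M[R]_(n, l)) :
  psdmx A -> loewner_le (nystrom A W) A.
Proof.
move=> /psd_sqrt[B [sB AE]]; rewrite /loewner_le (nystromE _ sB AE) AE.
rewrite -[X in X *m B - _]mulmx1 -mulmxBl -mulmxBr.
exact/psd_mulmx_sym/psd_range_proj_compl.
Qed.

Lemma nystrom_drop_le n k (A : 'M[R]_n) (W : 'M[R]_(n, k)) i :
  psdmx A -> loewner_le (nystrom_drop A W i) (nystrom A W).
Proof.
move=> /psd_sqrt[B [sB AE]].
rewrite /loewner_le /nystrom_drop !(nystromE _ sB AE) -mulmxBl -mulmxBr.
apply/psd_mulmx_sym/range_proj_le => //.
(* The reduced matrix consists of columns of [B *m W], which the larger projector fixes. *)
have -> : B *m col' i W = col' i (B *m W).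
  by apply/matrixP => a b; rewrite !mxE; apply: eq_bigr => c _; rewrite !mxE.
apply/matrixP => a b; rewrite -[in RHS](range_proj_id (B *m W)) !mxE.
by apply: eq_bigr => c _; rewrite !mxE.
Qed.

End MatrixFunctions.

Local Open Scope classical_set_scope.
Local Open Scope ring_scope.

(** * Measurability of matrix functions *)

Import HBNNSimple.
Section MeasurableMatrices.
Variables (R : realType) (d : measure_display) (T : measurableType d).

Definition measurable_mx m n (M : T -> 'M[R]_(m, n)) :=
  forall i j, measurable_fun [set: T] (fun w => M w i j).

Lemma measurable_funV (f : T -> R) :
  measurable_fun [set: T] f -> measurable_fun [set: T] (fun w => (f w)^-1).
Proof.
(* The square provides a nonnegative base, on which [powR] with exponent -1 is the reciprocal; the
   identity also holds where f vanishes, as 0^-1 = 0. *)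
move=> mf; have -> : (fun w => (f w)^-1) = (fun w => f w * powR (f w ^+ 2) (-1)).
  apply/funext => w; rewrite powR_inv1 ?sqr_ge0//.
  have [->|fw0] := eqVneq (f w) 0; first by rewrite invr0 mul0r.
  by field.
apply: measurable_funM => //.
apply: (measurableT_comp (measurable_powR _)).
exact: measurable_funX.
Qed.

Lemma measurable_mx_cst m n (A : 'M[R]_(m, n)) : measurable_mx (fun=> A).
Proof. by move=> i j; exact: measurable_cst. Qed.

Lemma measurable_mxD m n (M N : T -> 'M[R]_(m, n)) :
  measurable_mx M -> measurable_mx N -> measurable_mx (fun w => M w + N w).
Proof.
move=> mM mN i j; under eq_fun do rewrite mxE.
exact: measurable_funD.
Qed.

Lemma measurable_mxN m n (M : T -> 'M[R]_(m, n)) :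
  measurable_mx M -> measurable_mx (fun w => - M w).
Proof.
move=> mM i j; under eq_fun do rewrite mxE.
exact: measurable_funN.
Qed.

Lemma measurable_mxM m n p (M : T -> 'M[R]_(m, n)) (N : T -> 'M[R]_(n, p)) :
  measurable_mx M -> measurable_mx N -> measurable_mx (fun w => M w *m N w).
Proof.
move=> mM mN i j; under eq_fun do rewrite mxE.
by apply: measurable_sum => l; exact: measurable_funM.
Qed.

Lemma measurable_mx_tr m n (M : T -> 'M[R]_(m, n)) :
  measurable_mx M -> measurable_mx (fun w => (M w)^T).
Proof.
move=> mM i j; rewrite (_ : (fun w => _) = (fun w => M w j i)); first exact: mM.
by apply/funext => w; rewrite mxE.
Qed.

Lemma measurable_trace n (M : T -> 'M[R]_n) :
  measurable_mx M -> measurable_fun [set: T] (fun w => \tr (M w)).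
Proof. by move=> mM; apply: measurable_sum => i. Qed.

Lemma measurable_det n (M : T -> 'M[R]_n) :
  measurable_mx M -> measurable_fun [set: T] (fun w => \det (M w)).
Proof.
move=> mM; apply: measurable_sum => s; apply: measurable_funM => //.
by apply: measurable_prod => i _.
Qed.

Lemma measurable_mxV n (M : T -> 'M[R]_n) : (forall w, M w \in unitmx) ->
  measurable_mx M -> measurable_mx (fun w => invmx (M w)).
Proof.
move=> uM mM i j; rewrite /invmx; under eq_fun do rewrite uM !mxE.
apply: measurable_funM; first exact/measurable_funV/measurable_det.
apply: measurable_funM => //; apply: measurable_det => a b.
rewrite (_ : (fun w => _) = (fun w => M w (lift j a) (lift i b))); first exact: mM.
by apply/funext => w; rewrite !mxE.
Qed.

Variables (n : nat) (M : T -> 'M[R]_n).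
Hypotheses (sM : forall w, (M w)^T = M w) (mM : measurable_mx M).

(** This class is closed under sums, products, reciprocals of nowhere-zero functions and pointwise
    limits. It is enlarged from constants and the identity to indicators of rays, of Borel sets, and
    then to nonnegative Borel functions. *)
Let good (g : R -> R) := measurable_mx (fun w => funmx g (M w)).

Let good_cst c : good (fun=> c).
Proof.
rewrite /good (_ : (fun w => _) = (fun=> c%:M)); first exact: measurable_mx_cst.
by apply/funext => w; rewrite funmx_cst.
Qed.

Let good_id : good id.
Proof.
rewrite /good (_ : (fun w => _) = M) //.
by apply/funext => w; rewrite funmx_id.
Qed.

Let goodD g h : good g -> good h -> good (fun x => g x + h x).
Proof.
move=> gg gh; rewrite /good.
under eq_fun do rewrite funmxD//.
exact: measurable_mxD.
Qed.

Let goodM g h : good g -> good h -> good (fun x => g x * h x).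
Proof.
move=> gg gh; rewrite /good.
under eq_fun do rewrite funmxM//.
exact: measurable_mxM.
Qed.

Let goodX g m : good g -> good (fun x => g x ^+ m).
Proof.
move=> gg; elim: m => [|m IH]; first exact: good_cst.
by under eq_fun do rewrite exprS; exact: goodM.
Qed.

Let goodV g : (forall x, g x != 0) -> good g -> good (fun x => (g x)^-1).
Proof.
move=> g0 gg; rewrite /good.
under eq_fun do rewrite funmxV//.
apply: measurable_mxV => // w.
have : funmx g (M w) *m funmx (fun x => (g x)^-1) (M w) = 1%:M.
  rewrite -funmxM// -(funmx_cst 1 (sM w)); apply: eq_funmx => x.
  by rewrite mulfV.
by case/mulmx1_unit.
Qed.

Let good_sum (I : Type) (s : seq I) (g : I -> R -> R) :
  (forall i, good (g i)) -> good (fun x => \sum_(i <- s) g i x).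
Proof.
move=> gg; elim: s => [|i s IH].
  by under eq_fun do rewrite big_nil; exact: good_cst.
by under eq_fun do rewrite big_cons; exact: goodD.
Qed.

Let good_cvg (h : nat -> R -> R) g :
  (forall m, good (h m)) -> (forall x, (h ^~ x @ \oo --> g x)%classic) -> good g.
Proof.
move=> gh hg i j; apply: (@measurable_fun_cvg _ _ _ _ (fun m w => funmx (h m) (M w) i j)).
  by move=> m; exact: gh.
by move=> w _; apply: funmx_cvg.
Qed.

(* With [y = x - a], the ratio [(1 + y)^2 / (1 + y^2)] compares to [1] as [y]
   does to [0], so the powers below single out the sign of [y]. *)
Let good_ray a : good (\1_(`]a, +oo[%classic) : R -> R).
Proof.
pose r (x : R) := (1 + (x - a)) ^+ 2.
pose t (x : R) := 1 + (x - a) ^+ 2.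
have t0 x : 0 < t x by rewrite ltr_wpDr ?sqr_ge0.
have rt m x : t x ^+ m + r x ^+ m != 0.
  by rewrite gt_eqF// ltr_pwDl ?exprn_gt0// exprn_ge0// sqr_ge0.
have gy : good (fun x => x - a) by apply: goodD.
have gr : good r by apply/goodX/goodD.
have gt : good t by apply/goodD => //; exact: goodX.
pose h (x : R) : R := if x < a then 0 else if x == a then 2^-1 else 1.
have gh : good h.
  apply: (@good_cvg (fun m x => r x ^+ m * (t x ^+ m + r x ^+ m)^-1)) => [m|x].
    apply: goodM; first exact: goodX.
    by apply: goodV => //; apply: goodD; exact: goodX.
  rewrite /h; have [xa|ax|xa] := ltgtP x a.
  - have q1 : `|r x / t x| < 1.
      rewrite ger0_norm ?divr_ge0 ?sqr_ge0 ?ltW// ltr_pdivrMr// mul1r /r /t.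
      rewrite -subr_gt0 (_ : _ - _ = 2 * (a - x)); last by ring.
      by rewrite mulr_gt0// subr_gt0.
    rewrite (_ : (fun m => _) = (fun m => (r x / t x) ^+ m * (1 + (r x / t x) ^+ m)^-1)).
      set u := fun m => _; suff : (u @ \oo --> (0 * (1 + 0)^-1 : R))%classic by rewrite mul0r.
      apply: cvgM; first exact: cvg_expr.
      apply: cvgV; first by rewrite addr0.
      by apply: cvgD; [exact: cvg_cst|exact: cvg_expr].
    apply/funext => m; rewrite expr_div_n; have tm : t x ^+ m != 0 by rewrite gt_eqF// exprn_gt0.
    have := rt m x; set u := t x ^+ m in tm *; set v := r x ^+ m => uv.
    by field; rewrite uv tm.
  - have rx : 0 < r x by rewrite exprn_gt0//; lra.
    have q1 : `|t x / r x| < 1.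
      rewrite ger0_norm ?divr_ge0 ?sqr_ge0 ?ltW// ltr_pdivrMr// mul1r /r /t.
      rewrite -subr_gt0 (_ : _ - _ = 2 * (x - a)); last by ring.
      by rewrite mulr_gt0// subr_gt0.
    rewrite (_ : (fun m => _) = (fun m => ((t x / r x) ^+ m + 1)^-1)).
      set u := fun m => _.
      suff : (u @ \oo --> ((0 + 1)^-1 : R))%classic by rewrite add0r invr1.
      apply: cvgV; first by rewrite add0r.
      by apply: cvgD; [exact: cvg_expr|exact: cvg_cst].
    apply/funext => m; rewrite expr_div_n; have rm : r x ^+ m != 0 by rewrite gt_eqF// exprn_gt0.
    have := rt m x; set u := t x ^+ m; set v := r x ^+ m in rm * => uv.
    by field; rewrite uv rm.
  - rewrite (_ : (fun m => _) = (fun m => 2^-1)); first exact: cvg_cst.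
    apply/funext => m; rewrite /r /t xa subrr expr0n/= !addr0 expr1n expr1n.
    by rewrite div1r.
(* Taking powers once more sends the value 1/2 at x = a to 0 and keeps 0 and 1, which leaves the
   open ray. *)
apply: (@good_cvg (fun m x => h x ^+ m)) => [m|x]; first exact: goodX.
rewrite /h indicE mem_setE in_itv/= andbT; have [xa|ax|xa] := ltgtP x a.
- by apply: cvg_expr; rewrite normr0.
- by under eq_fun do rewrite expr1n; exact: cvg_cst.
- by apply: cvg_expr; rewrite ger0_norm//; lra.
Qed.

Let good_indic (A : set R) : measurable A -> good (\1_A : R -> R).
Proof.
rewrite [measurable](RGenOInfty.measurableE R).
move: A; apply: (@smallest_sub _ _ _ [set A | good (\1_A : R -> R)]).
  2: by move=> _ [x ->]; exact: good_ray.
have goodC B : good (\1_B : R -> R) -> good (\1_(~` B)%classic : R -> R).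
  move=> gB; have -> : (\1_(~` B)%classic : R -> R) = fun x => 1 + -1 * \1_B x.
    by apply/funext => x; rewrite !indicE in_setC; case: (x \in B); rewrite /=; ring.
  by apply: goodD => //; exact: goodM.
have goodI B C : good (\1_B : R -> R) -> good (\1_C : R -> R) ->
    good (\1_(B `&` C)%classic : R -> R).
  by move=> gB gC; rewrite indicI; exact: goodM.
have goodU B C : good (\1_B : R -> R) -> good (\1_C : R -> R) ->
    good (\1_(B `|` C)%classic : R -> R).
  move=> gB gC; have -> : B `|` C = ~` (~` B `&` ~` C) by rewrite setCI !setCK.
  by apply: (goodC _); apply: goodI; exact: (goodC _).
split.
- by rewrite /= indic0; exact: good_cst.
- by move=> B /= gB; rewrite setTD; exact: goodC.
move=> F gF /=.
(* At each point the indicators of the finite unions are eventually constant, so their limit gives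
   the countable union. *)
have gU m : good (\1_(\bigcup_(i < m) F i)%classic : R -> R).
  elim: m => [|m IH]; first by rewrite bigcup_mkord big_ord0 indic0; exact: good_cst.
  by rewrite bigcup_mkord big_ord_recr/= -bigcup_mkord; apply: goodU; [exact: IH|exact: gF].
apply: (good_cvg gU) => x; apply: cvg_near_cst.
have [[i _ Fix]|nF] := pselect ((\bigcup_i F i)%classic x).
  exists i.+1 => // m /= im; rewrite !indicE !mem_set//; first by exists i.
  by exists i.
near=> m; rewrite !indicE !memNset//.
by move=> [i _ Fi]; apply: nF; exists i.
Unshelve. all: by end_near. Qed.

(* Operator monotone functions may jump at 0, as the indicator of ]0, +oo[ does,
   so continuity of [M |-> g(M)] is not available. *)
Lemma measurable_funmx (g : R -> R) : measurable_fun [set: R] g ->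
  (forall x, 0 <= g x) -> measurable_mx (fun w => funmx g (M w)).
Proof.
move=> mg g0; have mEg : measurable_fun [set: R] (EFin \o g) by exact/measurable_EFinP.
have [h [_ hg]] := approximation measurableT mEg (fun x _ => g0 x : (0 <= (EFin \o g) x)%E).
apply: (@good_cvg h) => [m|x]; last exact: (fine_cvg (hg x Logic.I)).
have /funext -> := fimfunEord (h m).
by apply: good_sum => y; apply: goodM => //; exact: good_indic.
Qed.

End MeasurableMatrices.

(** * Densities and measures on tuples *)

Section Density.
Context d (T : measurableType d) (R : realType).
Variables (mu nu : {measure set T -> \bar R}) (p : T -> R).
Hypotheses (p0 : forall x, 0 <= p x) (mp : measurable_fun [set: T] p).
Hypothesis nuE : forall A, measurable A -> (nu A = \int[mu]_(x in A) (p x)%:E)%E.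
Local Open Scope ereal_scope.

Let density_indic E : measurable E ->
  \int[nu]_x (\1_E x)%:E = \int[mu]_x ((\1_E x)%:E * (p x)%:E).
Proof.
move=> mE; rewrite integral_indic// setIT nuE// integral_mkcond.
apply: eq_integral => x _; rewrite patchE indicE.
by case: ifPn => xE; rewrite ?mul1e ?mul0e.
Qed.

Let density_nnsfun (f : {nnsfun T >-> R}) :
  \int[nu]_x (f x)%:E = \int[mu]_x ((f x)%:E * (p x)%:E).
Proof.
have mEp : measurable_fun [set: T] (EFin \o p) by exact/measurable_EFinP.
under [LHS]eq_integral do rewrite fimfunE -fsumEFin//.
rewrite [LHS]ge0_integral_fsum//; last 2 first.
  - by move=> r; exact/measurable_EFinP/measurableT_comp.
  - by move=> n x _; rewrite EFinM nnfun_muleindic_ge0.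
under [RHS]eq_integral.
  move=> x xD; rewrite fimfunE -fsumEFin// muleC ge0_mule_fsumr; last first.
    by move=> r; rewrite EFinM nnfun_muleindic_ge0.
  over.
rewrite [RHS]ge0_integral_fsum//; last 2 first.
  - move=> r; apply: emeasurable_funM => //.
    by apply/measurable_EFinP; apply: measurable_funM.
  - move=> n x _; apply: mule_ge0; first by rewrite lee_fin.
    by rewrite EFinM nnfun_muleindic_ge0.
apply: eq_fsbigr => r _; rewrite integralZl_indic_nnsfun//= density_indic//.
have [r0|r0] := leP 0%R r.
  rewrite -ge0_integralZl//.
  - by apply: eq_integral => x _; rewrite [RHS]muleC EFinM -muleA.
  - by apply: emeasurable_funM => //; apply/measurable_EFinP.
  - by move=> x _; rewrite -EFinM lee_fin mulr_ge0.
(* The sum runs over all real r; over a negative one a nonnegative simple function has empty fibre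
   and both sides vanish. *)
have -> : f @^-1` [set r] = set0 by rewrite preimage_nnfun0.
rewrite !integral0_eq ?mule0// => x _; rewrite indic0 ?mulr0 ?mule0 ?mul0e//.
Qed.

Lemma ge0_integral_density (f : T -> \bar R) : measurable_fun [set: T] f ->
  (forall x, 0 <= f x) -> \int[nu]_x f x = \int[mu]_x (f x * (p x)%:E).
Proof.
move=> mf f0; pose f_ := nnsfun_approx measurableT mf.
have cf x : EFin \o f_^~ x @ \oo --> f x by exact: cvg_nnsfun_approx.
transitivity (lim (\int[nu]_x (f_ n x)%:E @[n --> \oo])).
  rewrite -monotone_convergence//=.
  - by apply: eq_integral => x _; apply/esym/cvg_lim => //; exact: cf.
  - by move=> n; exact/measurable_EFinP/measurable_funTS.
  - by move=> n ? _; rewrite lee_fin.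
  - by move=> ? _ ? ? mn; rewrite lee_fin; exact/lefP/nd_nnsfun_approx.
under eq_fun do rewrite density_nnsfun.
rewrite -monotone_convergence//=.
- apply: eq_integral => x _; apply/cvg_lim => //.
  rewrite muleC; under eq_fun do rewrite muleC.
  by apply: cvgeZl => //; exact: cf.
- by move=> n; apply: emeasurable_funM; exact/measurable_EFinP.
- by move=> n ? _; rewrite -EFinM lee_fin mulr_ge0.
- move=> x _ a b mn; rewrite -!EFinM lee_fin ler_wpM2r//.
  exact/lefP/nd_nnsfun_approx.
Qed.

End Density.

Section TupleMeasures.
Context d (X : measurableType d) (R : realType) (m : nat).
Variables (m1 m2 : {measure set (m.-tuple X) -> \bar R}).

Lemma measurable_box (B : 'I_m -> set X) : (forall j, measurable (B j)) ->
  measurable [set t : m.-tuple X | forall j, B j (tnth t j)].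
Proof.
move=> mB; rewrite (_ : [set t | _] = \big[setI/setT]_(j < m) ((@tnth m X)^~ j @^-1` B j)).
  apply: bigsetI_measurable => j _; rewrite -[X in measurable X]setTI.
  exact: measurable_tnth.
apply/seteqP; split => t /=; rewrite -bigcap_seq => Bt j.
  by move=> _; exact: Bt.
by apply: Bt => /=; rewrite mem_index_enum.
Qed.

(** Boxes are stable under intersection, generate the product sigma-algebra and include the whole
    space, on which [m1] is finite. *)
Lemma tuple_measure_unique :
  (m1 [set: m.-tuple X] < +oo)%E ->
  (forall B : 'I_m -> set X, (forall j, measurable (B j)) ->
    m1 [set t | forall j, B j (tnth t j)] = m2 [set t | forall j, B j (tnth t j)]) ->
  forall A, measurable A -> m1 A = m2 A.
Proof.
move=> fin1 m12 A mA.
pose G : set (set (m.-tuple X)) := [set C | exists2 B : 'I_m -> set X,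
  (forall j, measurable (B j)) & C = [set t | forall j, B j (tnth t j)]].
apply: (@measure_unique _ _ _ G (fun=> setT)) => //.
- apply/seteqP; split.
    apply: smallest_sub; first exact: smallest_sigma_algebra.
    move=> C; rewrite -bigcup_seq => -[i _ [B mB <-]].
    (* The preimage of a set under one coordinate is a box whose other sides are full. *)
    apply: sub_sigma_algebra; exists (fun j => if j == i then B else setT).
      by move=> j; case: ifP.
    apply/seteqP; split => t /=.
      by move=> [_ Bt] j; case: eqP => [->|].
    by move=> /(_ i); rewrite eqxx.
  apply: smallest_sub; first exact: sigma_algebra_measurable.
  by move=> _ [B mB ->]; exact: measurable_box.
- move=> _ _ [B mB ->] [C mC ->]; exists (fun j => B j `&` C j).
    by move=> j; exact: measurableI.
  by apply/seteqP; split => t /= => [[Bt Ct] j|BC]; [|split=> j; have [] := BC j].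
- by move=> i; exists (fun=> setT) => //; apply/seteqP; split.
- by rewrite bigcup_const.
- by move=> _ [B mB ->]; exact: m12.
Qed.

End TupleMeasures.

(** * Gaussian moments *)

Section NormalMoments.
Variable R : realType.
Let phi : R -> R := normal_pdf 0 1.
Let mu := @lebesgue_measure R.

Let phiE x : phi x = normal_peak 1 * expR (- (x ^+ 2 / 2)).
Proof.
rewrite /phi normal_pdfE ?oner_eq0// /normal_fun subr0 expr1n.
by rewrite mulNr.
Qed.

Let is_derive_phi (x : R) : is_derive x 1 phi (- (x * phi x)).
Proof.
rewrite (_ : phi = fun x => normal_peak 1 * expR (- (x ^+ 2 / 2))); last exact/funext/phiE.
apply: is_derive_eq; rewrite /GRing.scale/=.
by field.
Qed.

Let cphi : continuous phi.
Proof. exact: continuous_normal_pdf. Qed.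

Let xphi m (x : R) := x ^+ m * phi x.

Let cxphi m : continuous (xphi m).
Proof. by move=> x; apply: cvgM; [exact: exprn_continuous|exact: cphi]. Qed.

Let is_derive_xphi m (x : R) : is_derive x 1 (xphi m.+1) (m.+1%:R * xphi m x - xphi m.+2 x).
Proof.
have -> : xphi m.+1 = (id ^+ m.+1) * phi.
  by apply/funext => y; rewrite /xphi /GRing.mul/= exprfctE.
apply: is_derive_eq (is_deriveM (is_deriveX m.+1 (is_derive_id x 1)) (is_derive_phi x)) _.
rewrite /xphi /GRing.scale/= exprfctE !exprS; ring.
Qed.

Let xphi_even_ge0 i x : 0 <= xphi i.*2 x.
Proof. by rewrite mulr_ge0 ?normal_pdf_ge0// -mul2n exprM exprn_ge0// sqr_ge0. Qed.

Let cvg_xphi m : xphi m n%:R @[n --> \oo] --> (0 : R).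
Proof.
(* With y = x^2 / 2 and x >= 1, x^(m+1) <= x^(2(m+1)) = 2^(m+1) y^(m+1) <= 2^(m+1) (m+1)! exp(y),
   hence x^m phi(x) <= K / x. *)
pose K : R := normal_peak 1 * (m.+1`!%:R * 2 ^+ m.+1).
have K0 : 0 <= K by rewrite mulr_ge0 ?normal_peak_ge0// mulr_ge0// exprn_ge0.
have bound (x : R) : 1 <= x -> xphi m x <= K * x^-1.
  move=> x1; have x0 : 0 < x by exact: lt_le_trans x1.
  rewrite ler_pdivlMr// /xphi phiE mulrAC -exprSr mulrCA /K.
  rewrite ler_wpM2l ?normal_peak_ge0// expRN -ler_pdivlMr ?invr_gt0 ?expR_gt0// invrK.
  have h : (x ^+ 2 / 2) ^+ m.+1 / m.+1`!%:R <= expR (x ^+ 2 / 2).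
    apply: le_trans (expR_ge1Dxn m _); first by rewrite lerDr.
    by rewrite divr_ge0// sqr_ge0.
  move: h; rewrite expr_div_n ler_pdivrMr ?ltr0n ?fact_gt0//.
  rewrite ler_pdivrMr ?exprn_gt0// => h.
  apply: le_trans (_ : (x ^+ 2) ^+ m.+1 <= _).
    by rewrite -exprM ler_weXn2l// leq_pmull.
  by apply: le_trans h _; rewrite -mulrA mulrC.
rewrite -cvg_shiftS; apply: (@squeeze_cvgr _ _ _ _ (cst 0) (fun n => K * harmonic n)).
- near=> n; rewrite mulr_ge0 ?normal_pdf_ge0 ?exprn_ge0//=.
  by apply: bound; rewrite ler1n.
- exact: cvg_cst.
- rewrite -(mulr0 K); apply: cvgM; [exact: cvg_cst|exact: cvg_harmonic].
Unshelve. all: by end_near. Qed.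

Let integrable_xphi m (a b : R) : mu.-integrable `[a, b] (EFin \o xphi m).
Proof.
apply: continuous_compact_integrable; first exact: segment_compact.
by apply: continuous_subspaceT; exact: cxphi.
Qed.

(* Integrates the derivative of [x^(m+1) phi(x)]. *)
Let step_compact m n :
  (\int[mu]_(x in `[0%R, n%:R]) (xphi m.+2 x)%:E + (xphi m.+1 n%:R)%:E =
   m.+1%:R%:E * \int[mu]_(x in `[0%R, n%:R]) (xphi m x)%:E)%E.
Proof.
(* The fundamental theorem is applied on an interval of positive length; at n = 0 both sides are
   0. *)
case: n => [|n].
  by rewrite set_itv1 !integral_set1 mule0 /xphi expr0n/= mul0r adde0.
have FTC : (\int[mu]_(x in `[0%R, n.+1%:R]) (m.+1%:R * xphi m x - xphi m.+2 x)%:E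
    = (xphi m.+1 n.+1%:R)%:E)%E.
  rewrite (@continuous_FTC2 _ _ (xphi m.+1)) ?ltr0n//.
  - by rewrite {2}/xphi expr0n mul0r sube0.
  - apply: continuous_subspaceT => x; apply: cvgB; last exact: cxphi.
    by apply: cvgM; [exact: cvg_cst|exact: cxphi].
  - split => [x _||].
    + by have [] := is_derive_xphi m x.
    + by apply: cvg_at_right_filter; exact: cxphi.
    + by apply: cvg_at_left_filter; exact: cxphi.
  - by move=> x _; rewrite derive1E; have [_] := is_derive_xphi m x.
have : (m.+1%:R%:E * \int[mu]_(x in `[0%R, n.+1%:R]) (xphi m x)%:E = 
   \int[mu]_(x in `[0%R, n.+1%:R]) ((m.+1%:R * xphi m x - xphi m.+2 x)%:E + (xphi m.+2 x)%:E))%E.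
  rewrite -integralZl//; last exact: integrable_xphi.
  by apply: eq_integral => x _; rewrite -EFinD subrK EFinM.
rewrite integralD//=.
- by rewrite FTC addeC => ->.
- apply: continuous_compact_integrable; first exact: segment_compact.
  apply: continuous_subspaceT => x; apply: cvgB; last exact: cxphi.
  by apply: cvgM; [exact: cvg_cst|exact: cxphi].
- exact: integrable_xphi.
Qed.

(** The limit of [step_compact], whose boundary term tends to 0. Even exponents make the integrand
    nonnegative on the whole line, so the integrals over [0, n] converge even before they are known
    to be bounded. *)
Let half_moment i :
  (\int[mu]_(x in `[0%R, +oo[) (xphi i.*2.+2 x)%:E =
   i.*2.+1%:R%:E * \int[mu]_(x in `[0%R, +oo[) (xphi i.*2 x)%:E)%E.
Proof.
have mx m : measurable_fun [set: R] (xphi m).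
  by apply: continuous_measurable_fun; exact: cxphi.
have c1 := @ge0_cvgn_integral R mu _ (xphi_even_ge0 i.+1) (mx _).
have c2 := @ge0_cvgn_integral R mu _ (xphi_even_ge0 i) (mx _).
have L1 := cvgeZl (erefl : i.*2.+1%:R%:E \is a fin_num) c2.
have L2 : (i.*2.+1%:R%:E * \int[mu]_(x in `[0%R, n%:R]) (xphi i.*2 x)%:E)%E @[n --> \oo] -->
    (\int[mu]_(x in `[0%R, +oo[) (xphi i.*2.+2 x)%:E)%E.
  rewrite (_ : (fun n : nat => _) = (fun n : nat =>
      \int[mu]_(x in `[0%R, n%:R]) (xphi i.*2.+2 x)%:E + (xphi i.*2.+1 n%:R)%:E)%E).
    rewrite -[X in _ --> X]adde0; apply: cvgeD => //.
      by rewrite fin_num_adde_defl.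
    by apply: cvg_EFin; [near=> n|exact: cvg_xphi].
  by apply/funext => n; rewrite -step_compact.
exact: cvg_unique L2 L1.
Unshelve. all: by end_near. Qed.

Let half_moment0 : (\int[mu]_(x in `[0%R, +oo[) (xphi 0 x)%:E = 2^-1%:E)%E.
Proof.
have e : (2%:E * \int[mu]_(x in `[0%R, +oo[) (xphi 0 x)%:E = 1)%E.
  rewrite -(@integral_normal_pdf R 0 1).
  transitivity (\int[mu]_x (xphi 0 x)%:E)%E.
  rewrite (@ge0_symfun_integralT _ (xphi 0)).
  - by congr (_ * integral _ _ _)%E; apply/seteqP; split => x; rewrite /= in_itv/= andbT.
  - exact: (xphi_even_ge0 0).
  - exact: cxphi.
  - by move=> x; rewrite /xphi /= !phiE sqrrN.
  by apply: eq_integral => x _; rewrite /xphi expr0 mul1r.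
have -> : (\int[mu]_(x in `[0%R, +oo[) (xphi 0 x)%:E =
    2^-1%:E * (2%:E * \int[mu]_(x in `[0%R, +oo[) (xphi 0 x)%:E))%E.
  by rewrite muleA -EFinM mulVf ?mul1e// pnatr_eq0.
by rewrite e mule1.
Qed.

Let half_moment2 : (\int[mu]_(x in `[0%R, +oo[) (xphi 2 x)%:E = 2^-1%:E)%E.
Proof. by rewrite (half_moment 0) half_moment0 mul1e. Qed.

Let half_moment4 : (\int[mu]_(x in `[0%R, +oo[) (xphi 4 x)%:E = (3 / 2)%:E)%E.
Proof. by rewrite (half_moment 1) half_moment2 -EFinM. Qed.

Let integrable_half i (r : R) : (\int[mu]_(x in `[0%R, +oo[) (xphi i.*2 x)%:E = r%:E)%E ->
  mu.-integrable `[0%R, +oo[ (EFin \o xphi i.*2).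
Proof.
move=> Er; apply/integrableP; split.
  apply/measurable_EFinP; apply: measurable_funTS.
  by apply: continuous_measurable_fun; exact: cxphi.
set I := (X in (X < _)%E); suff -> : I = r%:E by rewrite ltry.
by rewrite -Er; apply: eq_integral => x _; rewrite gee0_abs// lee_fin.
Qed.

(** Folding cancels the odd powers of a polynomial times [phi] inside the integrand, so half-line
    moments of even order suffice. *)
Let integral_fold (g : R -> R) : (forall x, 0 <= g x) -> continuous g ->
  (\int[mu]_x (g x)%:E = \int[mu]_(x in `[0%R, +oo[) (g x + g (- x))%:E)%E.
Proof.
move=> g0 cg; have mg : measurable_fun [set: R] g by exact: continuous_measurable_fun.
rewrite -(setUv [set x : R | 0 <= x]) -set_itvcy ge0_integral_setU//=; last 4 first.
- exact: measurableC.
- by apply/measurable_EFinP; rewrite setUv.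
- by move=> x _; rewrite lee_fin.
- exact/disj_setPCl.
rewrite setCitvr integral_itv_bndo_bndc; last exact/measurable_EFinP/measurable_funTS.
rewrite -{2}oppr0 ge0_integration_by_substitutionNy//; last exact: continuous_subspaceT.
under [RHS]eq_integral do rewrite EFinD.
rewrite ge0_integralD//.
- by move=> x _; rewrite lee_fin.
- exact/measurable_EFinP/measurable_funTS.
- by move=> x _; rewrite lee_fin.
- by apply/measurable_EFinP/measurable_funTS/measurableT_comp.
Qed.

(** The Hermite polynomials s^2 - 1, s and 1 are orthogonal for the Gaussian law, with squared norms
    2, 1 and 1. *)
Lemma integral_normal_square (a b c : R) :
  (\int[normal_prob (0 : R) 1]_s ((a * (s ^+ 2 - 1) + b * s + c) ^+ 2)%:E
   = (2 * a ^+ 2 + b ^+ 2 + c ^+ 2)%:E)%E.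
Proof.
pose q (s : R) := a * (s ^+ 2 - 1) + b * s + c.
have cq : continuous q.
  move=> s; apply: cvgD; last exact: cvg_cst.
  apply: cvgD; last by apply: cvgM; [exact: cvg_cst|exact: cvg_id].
  apply: cvgM; first exact: cvg_cst.
  by apply: cvgB; [exact: exprn_continuous|exact: cvg_cst].
have cq2 : continuous (fun s => q s ^+ 2).
  by move=> s; apply: (cvg_comp q (fun x => x ^+ 2)); [exact: cq|exact: exprn_continuous].
rewrite (ge0_integral_density (mu := mu) (p := phi)).
- under eq_integral do rewrite -EFinM.
  rewrite (integral_fold (g := fun s => q s ^+ 2 * phi s)).
  + have E s : q s ^+ 2 * phi s + q (- s) ^+ 2 * phi (- s) =
       2 * a ^+ 2 * xphi 4 s + (2 * (b ^+ 2 + 2 * a * c - 2 * a ^+ 2) * xphi 2 s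
         + 2 * (c - a) ^+ 2 * xphi 0 s).
      by rewrite /q /xphi (_ : phi (- s) = phi s) ?phiE ?sqrrN//; ring.
    under eq_integral do rewrite E !EFinD !(EFinM (2 * _)).
    have i4 := integrable_half (i := 2) half_moment4.
    have i2 := integrable_half (i := 1) half_moment2.
    have i0 := integrable_half (i := 0) half_moment0.
    rewrite integralD//; last 2 first.
    * exact: integrableZl.
    * by apply: integrableD => //; exact: integrableZl.
    rewrite integralD//; [|exact: integrableZl..].
    rewrite !integralZl// half_moment4 half_moment2 half_moment0 -!EFinM -!EFinD.
    by congr EFin; field.
  + by move=> s; rewrite mulr_ge0 ?sqr_ge0 ?normal_pdf_ge0.
  + by move=> s; apply: cvgM; [exact: cq2|exact: cphi].
- by move=> s; exact: normal_pdf_ge0.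
- exact: measurable_normal_pdf.
- by [].
- by apply/measurable_EFinP; exact: continuous_measurable_fun.
- by move=> s; rewrite lee_fin sqr_ge0.
Qed.

End NormalMoments.

Definition mfun_of d d' (T : measurableType d) (T' : measurableType d')
    (f : T -> T') (mf : measurable_fun [set: T] f) : {mfun T >-> T'} :=
  HB.pack f (isMeasurableFun.Build _ _ _ _ f mf).

Lemma integral_cst_probability (R : realType) d (T : measurableType d)
  (P : probability T R) (r : R) : (\int[P]_x r%:E = r%:E)%E.
Proof.
rewrite integral_cst// -[RHS]mule1; congr (_ * _)%E.
exact: probability_setT.
Qed.

(** * Second moments of quadratic polynomials in a Gaussian vector *)

Section GaussianVectors.
Variable R : realType.

(** Stated for a measure on tuples rather than for a random variable, to allow induction on the
    dimension. *)
Definition gaussian_law n (m : {measure set (n.-tuple R) -> \bar R}) :=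
  forall B : 'I_n -> set R, (forall j, measurable (B j)) ->
    m [set t | forall j, B j (tnth t j)] = (\prod_(j < n) normal_prob (0 : R) 1 (B j))%E.

Let cons_tuple n (z : measurableTypeR R * n.-tuple R) : n.+1.-tuple R := [tuple of z.1 :: z.2].

Let measurable_cons_tuple n : measurable_fun [set: measurableTypeR R * n.-tuple R] (@cons_tuple n).
Proof. by apply: measurable_cons; [exact: measurable_fst|exact: measurable_snd]. Qed.

(** By agreement on boxes, [m] is the image of N(0, 1) times [m'] under prepending a coordinate. *)
Lemma gaussian_law_fubini n (m : probability (n.+1.-tuple R) R)
    (m' : probability (n.-tuple R) R) (F : n.+1.-tuple R -> \bar R) :
  gaussian_law m -> gaussian_law m' ->
  measurable_fun [set: n.+1.-tuple R] F -> (forall t, 0 <= F t)%E ->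
  (\int[m]_t F t = \int[m']_y \int[normal_prob (0 : R) 1]_x F [tuple of x :: y])%E.
Proof.
move=> gm gm' mF F0.
pose mm : probability (n.+1.-tuple R) R :=
  distribution (normal_prob (0 : R) 1 \x m')%E (mfun_of (@measurable_cons_tuple n)).
have mE A : measurable A -> m A = mm A.
  apply: (@tuple_measure_unique _ _ _ _ m mm).
    exact: le_lt_trans (probability_le1 m measurableT) (ltry 1).
  move=> B mB; rewrite gm// big_ord_recl /=.
  rewrite /mm /distribution /pushforward.
  rewrite (_ : _ @^-1` _ = B ord0 `*` [set t | forall j : 'I_n, B (lift ord0 j) (tnth t j)]).
    rewrite product_measure1E; first by congr (_ * _)%E; rewrite (gm' (fun j => B (lift ord0 j))).
    - exact: mB.
    - exact: (measurable_box (B := fun j => B (lift ord0 j))).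
  apply/seteqP; split => -[x y] /=.
    move=> h; split; first by have := h ord0.
    by move=> j; have := h (lift ord0 j); rewrite tnthS.
  move=> [Bx By] j; case: (unliftP ord0 j) => [i ->|->//].
  by rewrite tnthS.
rewrite (eq_measure_integral mm) => [|A mA _]; last exact: mE.
rewrite ge0_integral_distribution// fubini_tonelli2//=.
exact: measurableT_comp mF (measurable_cons_tuple (n:=n)).
Qed.

(** The Gaussian law of lower dimension needed by the induction is obtained as a marginal. *)
Lemma gaussian_law_behead n (m : probability (n.+1.-tuple R) R) :
  gaussian_law m -> exists m' : probability (n.-tuple R) R, gaussian_law m'.
Proof.
move=> gm; exists (distribution m (mfun_of (@measurable_behead _ R n))) => B mB.
pose B' (j : 'I_n.+1) := if unlift ord0 j is Some i then B i else setT.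
transitivity (m [set t | forall j, B' j (tnth t j)]).
  congr (m _); apply/seteqP; split => t /=.
    move=> Bt j; rewrite /B'; case: unliftP => [i ->|//].
    by have := Bt i; rewrite tnth_behead (_ : inord _ = lift ord0 i)//;
      apply: val_inj; rewrite /= inordK// ltnS.
  move=> Bt j; have := Bt (lift ord0 j); rewrite /B' liftK.
  rewrite tnth_behead (_ : inord _ = lift ord0 j)//.
  by apply: val_inj; rewrite /= inordK// ltnS.
rewrite gm => [|j]; last by rewrite /B'; case: unlift.
rewrite big_ord_recl /B' unlift_none probability_setT mul1e.
by apply: eq_bigr => i _; rewrite liftK.
Qed.

(** A quadratic form centred by its Gaussian mean, the trace. The affine part makes the family
    stable under fixing a coordinate, since cross terms then become linear. *)
Definition quadratic n (M : 'I_n -> 'I_n -> R) (v : 'I_n -> R) (c : R) (t : n.-tuple R) : R :=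
  \sum_i \sum_j M i j * (tnth t i * tnth t j) - \sum_i M i i
  + \sum_i v i * tnth t i + c.

Lemma measurable_quadratic n M v c : measurable_fun [set: n.-tuple R] (quadratic M v c).
Proof.
apply: measurable_funD => //; apply: measurable_funD.
  apply: measurable_funB => //; apply: measurable_sum => i.
  apply: measurable_sum => j; apply: measurable_funM => //.
  by apply: measurable_funM; exact: measurable_tnth.
by apply: measurable_sum => i; apply: measurable_funM => //; exact: measurable_tnth.
Qed.

Lemma measurable_quadratic_sqr n M v c :
  measurable_fun [set: n.-tuple R] (fun t => (quadratic M v c t ^+ 2)%:E).
Proof.
apply/measurable_EFinP; apply: measurable_funX; exact: measurable_quadratic.
Qed.

(* Peeling off the first coordinate [s] leaves, for fixed remaining coordinates,
   an expression [a (s^2 - 1) + b s + c']. *)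
Lemma gaussian_quadratic n (m : probability (n.-tuple R) R)
    (M : 'I_n -> 'I_n -> R) (v : 'I_n -> R) (c : R) :
  gaussian_law m -> (forall i j, M i j = M j i) ->
  (\int[m]_t (quadratic M v c t ^+ 2)%:E
   = (2 * (\sum_i \sum_j M i j ^+ 2) + \sum_i v i ^+ 2 + c ^+ 2)%:E)%E.
Proof.
elim: n m M v c => [|n IHn] m M v c gm sM.
  under eq_integral do rewrite /quadratic !big_ord0 subr0 !add0r.
  by rewrite !big_ord0 mulr0 !add0r integral_cst_probability.
have [m' gm'] := gaussian_law_behead gm.
rewrite (gaussian_law_fubini gm gm') => [||t]; last by rewrite lee_fin sqr_ge0.
  2: exact: measurable_quadratic_sqr.
pose M' i j := M (lift ord0 i) (lift ord0 j).
pose u i := 2 * M ord0 (lift ord0 i).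
pose v' i := v (lift ord0 i).
pose z (i j : 'I_n) : R := 0.
(* As a polynomial in s: a = M 0 0, b gathers the doubled cross terms and v 0, c' is the rest. Both
   b (with zero matrix [z]) and c' are instances of [quadratic], so the induction hypothesis applies
   to each. *)
transitivity (\int[m']_y ((2 * M ord0 ord0 ^+ 2)%:E
    + ((quadratic z u (v ord0) y ^+ 2)%:E + (quadratic M' v' c y ^+ 2)%:E)))%E.
  apply: eq_integral => y _.
  rewrite -!EFinD addrA -integral_normal_square; apply: eq_integral => s _.
  congr ((_ ^+ 2)%:E); rewrite /quadratic !big_ord_recl /= !tnth0.
  pose L := \sum_i M ord0 (lift ord0 i) * tnth y i.
  pose Q := \sum_i \sum_j M' i j * (tnth y i * tnth y j).
  have -> : \sum_(i < n) M ord0 (lift ord0 i) * (s * tnth [tuple of s :: y] (lift ord0 i)) = s * L.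
    by rewrite mulr_sumr; apply: eq_bigr => i _; rewrite tnthS; ring.
  have -> : \sum_(i < n) \sum_(j < n.+1) M (lift ord0 i) j *
      (tnth [tuple of s :: y] (lift ord0 i) * tnth [tuple of s :: y] j) = s * L + Q.
    rewrite mulr_sumr -big_split; apply: eq_bigr => i _.
    rewrite big_ord_recl tnth0 tnthS sM /=; congr (_ + _); first by ring.
    by apply: eq_bigr => j _; rewrite tnthS.
  have -> : \sum_(i < n) v (lift ord0 i) * tnth [tuple of s :: y] (lift ord0 i)
      = \sum_i v' i * tnth y i by apply: eq_bigr => i _; rewrite tnthS.
  have -> : \sum_(i < n) \sum_(j < n) z i j * (tnth y i * tnth y j) = 0.
    by rewrite big1// => i _; rewrite big1// => j _; rewrite mul0r.
  have -> : \sum_(i < n) z i i = 0 by rewrite big1.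
  have -> : \sum_i u i * tnth y i = 2 * L.
    by rewrite mulr_sumr; apply: eq_bigr => i _; rewrite /u mulrA.
  rewrite -/Q; ring.
rewrite ge0_integralD//; last 3 first.
- by move=> y _; rewrite lee_fin mulr_ge0// sqr_ge0.
- by move=> y _; rewrite adde_ge0// lee_fin sqr_ge0.
- by apply: emeasurable_funD; exact: measurable_quadratic_sqr.
rewrite ge0_integralD//; last 4 first.
- by move=> y _; rewrite lee_fin sqr_ge0.
- exact: measurable_quadratic_sqr.
- by move=> y _; rewrite lee_fin sqr_ge0.
- exact: measurable_quadratic_sqr.
rewrite integral_cst_probability !IHn//; last by move=> i j; exact: sM.
rewrite -!EFinD; congr EFin; rewrite !big_ord_recl.
have -> : \sum_(i < n) \sum_(j < n) z i j ^+ 2 = 0.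
  by rewrite big1// => i _; rewrite big1// => j _; rewrite expr0n.
(* The term 4 S = 2 (S + S) accounts for the first row and the first column of [M] off the
   diagonal. *)
pose S := \sum_(i < n) M ord0 (lift ord0 i) ^+ 2.
have -> : \sum_(i < n) u i ^+ 2 = 4 * S.
  by rewrite mulr_sumr; apply: eq_bigr => i _; rewrite /u; ring.
have -> : \sum_(i < n) \sum_(j < n.+1) M (lift ord0 i) j ^+ 2
    = S + \sum_(i < n) \sum_(j < n) M' i j ^+ 2.
  rewrite -big_split; apply: eq_bigr => i _.
  by rewrite big_ord_recl sM.
rewrite -/S; ring.
Qed.

End GaussianVectors.

(** * The FlexTrace error *)

Section ScrF.
Variables (R : realType) (f : R -> R).
Hypothesis hf : in_scrF f.

Lemma funmx_scalar n (g : R -> R) (x : R) : funmx g (x%:M : 'M[R]_n) = (g x)%:M.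
Proof.
have := @funmx_spectral _ g n 1%:M (const_mx x).
rewrite trmx1 !mulmx1 !mul1mx diag_const_mx => ->//.
by rewrite (_ : map_mx g _ = const_mx (g x)) ?diag_const_mx//; apply/rowP => i; rewrite !mxE.
Qed.

Lemma psd_scalar n (x : R) : 0 <= x -> psdmx (x%:M : 'M[R]_n).
Proof. by move=> x0; rewrite -diag_const_mx; apply: psd_diag => i; rewrite mxE. Qed.

(** Operator monotonicity on 1 x 1 matrices; this yields Borel measurability. *)
Lemma scrF_nondecreasing x y : 0 <= x -> x <= y -> f x <= f y.
Proof.
move=> x0 xy; have [_ _ /(_ 1 x%:M y%:M)] := hf.
rewrite /loewner_le !funmx_scalar -!raddfB.
have y0 := le_trans x0 xy.
move=> /(_ (psd_scalar _ x0) (psd_scalar _ y0) (psd_scalar _ _)).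
rewrite subr_ge0 => /(_ xy) [_ /(_ 1%:M)].
by rewrite /quad_form trmx1 mulmx1 mul1mx mxE mulr1n subr_ge0.
Qed.

Lemma measurable_funmx_scrF d (T : measurableType d) n (M : T -> 'M[R]_n) :
  (forall w, psdmx (M w)) -> measurable_mx M -> measurable_mx (fun w => funmx f (M w)).
Proof.
move=> pM mM; have [f0 _ _] := hf.
(* [f] is arbitrary on negative reals; truncation makes it nondecreasing and nonnegative everywhere
   without changing its values on psd matrices. *)
rewrite (_ : (fun w => _) = (fun w => funmx (fun x => f (Num.max 0 x)) (M w))).
  apply: measurable_funmx => //; first by move=> w; have [] := pM w.
    apply: nondecreasing_measurable => // x y xy.
    apply: scrF_nondecreasing; first by rewrite le_max lexx.
    by rewrite ge_max !le_max lexx xy orbT.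
  by move=> x; apply: f0; rewrite le_max lexx.
apply/funext => w; apply: eq_funmx_psd => // x x0.
by rewrite max_r.
Qed.

End ScrF.

(** The projector form replaces the pseudoinverse by a Borel function, the indicator of x != 0,
    applied to a Gram matrix. *)
Lemma measurable_nystrom (R : realType) d (T : measurableType d) n l (A : 'M[R]_n)
    (W : T -> 'M[R]_(n, l)) :
  psdmx A -> measurable_mx W -> measurable_mx (fun w => nystrom A (W w)).
Proof.
move=> /psd_sqrt[B [sB AE]] mW.
under eq_fun do rewrite (nystromE _ sB AE).
have mX : measurable_mx (fun w => B *m W w).
  by apply: measurable_mxM => //; exact: measurable_mx_cst.
apply: measurable_mxM; last exact: measurable_mx_cst.
apply: measurable_mxM; first exact: measurable_mx_cst.
apply: (measurable_funmx (M := fun w => B *m W w *m (B *m W w)^T)).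
- by move=> w; have [] := psd_gram (B *m W w).
- by apply: measurable_mxM => //; exact: measurable_mx_tr.
- rewrite (_ : (fun x : R => _) = \1_(~` [set 0])); first exact/measurable_indic/measurableC.
  apply/funext => x; rewrite indicE; have [->|/eqP x0] := eqVneq x 0.
    by rewrite memNset//= => /(_ erefl).
  by rewrite mem_set.
- by [].
Qed.

Lemma measurable_quad_form (R : realType) d (T : measurableType d) n
    (M : T -> 'M[R]_n) (x : T -> 'cV[R]_n) :
  measurable_mx M -> measurable_mx x ->
  measurable_fun [set: T] (fun w => quad_form (M w) (x w)).
Proof.
move=> mM mx; apply: (@measurable_mxM _ _ _ _ _ _ (fun w => (x w)^T *m M w) x) => //.
by apply: measurable_mxM => //; exact: measurable_mx_tr.
Qed.

Lemma quad_form_sum (R : realType) n (M : 'M[R]_n) (x : 'cV[R]_n) :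
  quad_form M x = \sum_i \sum_j M i j * (x i ord0 * x j ord0).
Proof.
rewrite /quad_form mxE exchange_big; apply: eq_bigr => j _.
by rewrite mxE mulr_suml; apply: eq_bigr => i _; rewrite mxE; ring.
Qed.

Section ErrorBound.
Variables (R : realType) (f : R -> R) (n k : nat) (A : 'M[R]_n).
Hypotheses (hf : in_scrF f) (pA : psdmx A).

Definition nystrom_error l (W : 'M[R]_(n, l)) : 'M[R]_n :=
  funmx f A - funmx f (nystrom A W).

Lemma psd_nystrom_error l (W : 'M[R]_(n, l)) : psdmx (nystrom_error W).
Proof. by have [_ _] := hf; apply => //; [exact: psd_nystrom|exact: nystrom_le]. Qed.

(* The estimated quadratic form lies in [0, q], and on that interval the convex
   function (. - t)^2 is at most its sum over the endpoints. *)
Lemma flextrace_error (Omega : 'M[R]_(n, k)) : (0 < k)%N ->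
  (\tr (funmx f A) - flextrace f A Omega) ^+ 2 <=
  k%:R^-1 * \sum_(i < k)
    ((quad_form (nystrom_error (col' i Omega)) (col i Omega) - \tr (nystrom_error (col' i Omega))) ^+ 2
     + \tr (nystrom_error (col' i Omega)) ^+ 2).
Proof.
move=> k0; pose D i := nystrom_error (col' i Omega); have [_ _ fmon] := hf.
pose z i := quad_form (funmx f (nystrom A Omega) - funmx f (nystrom_drop A Omega i)) (col i Omega).
have k0' : k%:R != 0 :> R by rewrite pnatr_eq0 -lt0n.
have -> : \tr (funmx f A) - flextrace f A Omega = k%:R^-1 * \sum_(i < k) (\tr (D i) - z i).
  rewrite /flextrace -[X in X - _](mulKf k0') -mulrBr; congr (_ * _).
  have -> : k%:R * \tr (funmx f A) = \sum_(i < k) \tr (funmx f A).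
    by rewrite sumr_const card_ord mulr_natl.
  rewrite -sumrB; apply: eq_bigr => i _.
  by rewrite /D /z /nystrom_error raddfB /=; ring.
have bound i : (\tr (D i) - z i) ^+ 2 <=
    (quad_form (D i) (col i Omega) - \tr (D i)) ^+ 2 + \tr (D i) ^+ 2.
  have t0 : 0 <= \tr (D i) by apply: psd_trace_ge0; exact: psd_nystrom_error.
  have z0 : 0 <= z i.
    have [_] : psdmx (funmx f (nystrom A Omega) - funmx f (nystrom_drop A Omega i)).
      by apply: fmon; [exact: psd_nystrom|exact: psd_nystrom|exact: nystrom_drop_le].
    exact.
  have zq : z i <= quad_form (D i) (col i Omega).
    rewrite -subr_ge0 /z -quad_formB /D /nystrom_error opprB addrA addrNK.
  by have [_] := psd_nystrom_error Omega; exact.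
  move: t0 z0 zq; move: (\tr (D i)) (z i) (quad_form _ _) => t s q t0 s0 sq.
  (* If s <= t then (t - s)^2 <= t^2; otherwise t < s <= q and (t - s)^2 <= (q - t)^2. *)
  have [st|ts] := leP s t.
    have := mulr_ge0 s0 t0; have : 0 <= s * (t - s) by rewrite mulr_ge0 ?subr_ge0.
    by have := sqr_ge0 (q - t); nra.
  have : 0 <= (q - s) * (q - s) by rewrite mulr_ge0 ?subr_ge0.
  have : 0 <= (q - s) * (s - t) by rewrite mulr_ge0 ?subr_ge0// ltW.
  by have := sqr_ge0 t; nra.
apply: le_trans (ler_wpM2l _ (ler_sum _ (fun i _ => bound i))); last by rewrite invr_ge0 ler0n.
have cs (x : 'I_k -> R) : (\sum_i x i) ^+ 2 <= k%:R * \sum_i x i ^+ 2.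
  (* Lagrange's identity, from which Cauchy-Schwarz follows. *)
  have E : \sum_i \sum_j (x i - x j) ^+ 2 = 2 * (k%:R * \sum_i x i ^+ 2 - (\sum_i x i) ^+ 2).
    have -> : (\sum_i x i) ^+ 2 = \sum_i \sum_j x i * x j.
      by rewrite expr2 mulr_suml; apply: eq_bigr => i _; rewrite mulr_sumr.
    have s1 : \sum_(i < k) \sum_(j < k) x i ^+ 2 = k%:R * \sum_i x i ^+ 2.
      by rewrite mulr_sumr; apply: eq_bigr => i _; rewrite sumr_const card_ord mulr_natl.
    have s2 : \sum_(i < k) \sum_(j < k) x j ^+ 2 = k%:R * \sum_i x i ^+ 2.
      by rewrite sumr_const card_ord mulr_natl.
    rewrite mulrBr {1}(_ : 2 = 1 + 1)// mulrDl !mul1r -{1}s1 -s2 mulr_sumr -big_split -sumrB.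
    apply: eq_bigr => i _; rewrite mulr_sumr -big_split -sumrB.
    by apply: eq_bigr => j _ /=; ring.
  rewrite -subr_ge0 -(pmulr_rge0 _ (ltr0n R 2)) -E.
  by apply: sumr_ge0 => i _; apply: sumr_ge0 => j _; exact: sqr_ge0.
rewrite exprMn; apply: le_trans (ler_wpM2l _ (cs _)) _; first by rewrite sqr_ge0.
by rewrite expr2 -mulrA mulKf.
Qed.
End ErrorBound.

(** * Separating one independent variable from the others *)

Lemma measurable_mktuple d d' (T : measurableType d) (X : measurableType d') m
    (g : 'I_m -> T -> X) : (forall j, measurable_fun [set: T] (g j)) ->
  measurable_fun [set: T] (fun w => [tuple g j w | j < m]).
Proof.
move=> mg; apply/measurable_fun_tnthP => j.
rewrite (_ : _ \o _ = g j); first exact: mg.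
by apply/funext => w; rewrite /= tnth_mktuple.
Qed.

Section IndependentRVs.
Context d d' (T : measurableType d) (X : measurableType d') (R : realType).
Variables (P : probability T R) (k : nat) (omega : 'I_k.+1 -> {RV P >-> X}).
Hypothesis hindep : independent_RVs omega.

Definition drop_RV (i : 'I_k.+1) (w : T) : k.-tuple X :=
  [tuple omega (lift i j) w | j < k].

Lemma measurable_drop_RV i : measurable_fun [set: T] (drop_RV i).
Proof. by apply: measurable_mktuple => j; exact: measurable_funPT. Qed.

Definition drop_law i : probability (k.-tuple X) R :=
  distribution P (mfun_of (measurable_drop_RV i)).

Lemma drop_law_box i (B : 'I_k -> set X) : (forall j, measurable (B j)) ->
  drop_law i [set t | forall j, B j (tnth t j)]
  = (\prod_(j < k) distribution P (omega (lift i j)) (B j))%E.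
Proof.
(* Independence of the whole family is used with the sure event at index [i], which contributes a
   factor 1. *)
move=> mB; pose B' j := if unlift i j is Some j' then B j' else setT.
have mB' j : measurable (B' j) by rewrite /B'; case: unlift.
have := hindep [set: 'I_k.+1]%SET mB'; rewrite (bigD1_ord i) ?inE//=.
rewrite {2}/B' unlift_none preimage_setT [P setT]probability_setT mul1e.
under eq_bigr => j _ do rewrite /B' liftK.
under eq_bigl do rewrite inE.
move=> <-; rewrite /drop_law /distribution /pushforward; congr (P _).
apply/seteqP; split => w /= Bw j.
  move=> _; rewrite /B'; case: unliftP => [j' ->|//].
  by have := Bw j'; rewrite tnth_mktuple.
by have := Bw (lift i j); rewrite /B' liftK tnth_mktuple; apply; rewrite inE.
Qed.

Let ins i (z : X * k.-tuple X) : k.+1.-tuple X :=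
  [tuple (if unlift i j is Some j' then tnth z.2 j' else z.1) | j < k.+1].

Let measurable_ins i : measurable_fun [set: X * k.-tuple X] (ins i).
Proof.
apply: (measurable_mktuple (g := fun j z => if unlift i j is Some j' then tnth z.2 j' else z.1)) => j.
case: unlift => [j'|]; last exact: measurable_fst.
exact: measurableT_comp (measurable_tnth j') measurable_snd.
Qed.

Let full w : k.+1.-tuple X := [tuple omega j w | j < k.+1].

Let measurable_full : measurable_fun [set: T] full.
Proof. by apply: measurable_mktuple => j; exact: measurable_funPT. Qed.

(* The law of the whole family is the image of the product measure under the
   map inserting the i-th entry: both agree on boxes. *)
Lemma integral_independent i (G : X * k.-tuple X -> \bar R) :
  measurable_fun [set: X * k.-tuple X] G -> (forall z, 0 <= G z)%E ->
  (\int[P]_w G (omega i w, drop_RV i w)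
   = \int[drop_law i]_y \int[distribution P (omega i)]_x G (x, y))%E.
Proof.
move=> mG G0.
pose law : probability (k.+1.-tuple X) R := distribution P (mfun_of measurable_full).
pose mm : probability (k.+1.-tuple X) R :=
  distribution (distribution P (omega i) \x drop_law i)%E (mfun_of (measurable_ins i)).
have lawE A : measurable A -> law A = mm A.
  apply: (@tuple_measure_unique _ _ _ _ law mm).
    exact: le_lt_trans (probability_le1 law measurableT) (ltry 1).
  move=> B mB.
  transitivity (\prod_(j < k.+1) distribution P (omega j) (B j))%E.
    have := hindep [set: 'I_k.+1]%SET mB; under eq_bigl do rewrite inE.
    move=> <-; rewrite /law /distribution /pushforward; congr (P _).
    apply/seteqP; split => w /= Bw j.
      by move=> _; have := Bw j; rewrite tnth_mktuple.
    by have := Bw j; rewrite tnth_mktuple; apply; rewrite inE.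
  rewrite (bigD1_ord i)//=.
  rewrite -(drop_law_box i (B := fun j => B (lift i j)))//.
  pose C := B i `*` [set t | forall j, B (lift i j) (tnth t j)].
  transitivity ((distribution P (omega i) \x drop_law i)%E C).
    by rewrite product_measure1E//; exact: (measurable_box (B := fun j => B (lift i j))).
  have -> : C = ins i @^-1` [set t | forall j, B j (tnth t j)]; last by [].
  apply/seteqP; split => -[x y] /=.
    by move=> [Bx By] j; rewrite tnth_mktuple; case: unliftP => [j' ->|->] /=.
  move=> h; split; first by have := h i; rewrite tnth_mktuple unlift_none.
  by move=> j; have := h (lift i j); rewrite tnth_mktuple liftK.
(* [G] is rewritten as a function of the whole tuple, so that its integral can be moved from [law]
   to [mm]. *)
pose F (t : k.+1.-tuple X) := G (tnth t i, [tuple tnth t (lift i j) | j < k]).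
have mF : measurable_fun [set: k.+1.-tuple X] F.
  apply: (measurableT_comp mG); apply: measurable_fun_pair; first exact: measurable_tnth.
  by apply: (measurable_mktuple (g := fun j t => tnth t (lift i j))) => j; exact: measurable_tnth.
transitivity (\int[law]_t F t)%E.
  rewrite ge0_integral_distribution//; last by move=> t; exact: G0.
  apply: eq_integral => w _; rewrite /F /= tnth_mktuple; congr (G (_, _)).
  by apply: eq_from_tnth => j; rewrite !tnth_mktuple.
rewrite (eq_measure_integral mm) => [|A mA _]; last exact: lawE.
rewrite ge0_integral_distribution//; last by move=> t; exact: G0.
have -> : F \o mfun_of (measurable_ins i) = G.
  apply/funext => -[x y]; rewrite /F /= tnth_mktuple unlift_none; congr (G (_, _)).
  by apply: eq_from_tnth => j; rewrite !tnth_mktuple liftK.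
by rewrite fubini_tonelli2.
Qed.

(** Exchangeability in the form needed: both laws are products of the same marginals. *)
Lemma drop_law_unique i j : 
  (forall a b A, measurable A -> distribution P (omega a) A = distribution P (omega b) A) ->
  forall A, measurable A -> drop_law i A = drop_law j A.
Proof.
move=> idd; apply: (@tuple_measure_unique _ _ _ _ (drop_law i) (drop_law j)).
  exact: le_lt_trans (probability_le1 (drop_law i) measurableT) (ltry 1).
move=> B mB; apply: etrans (drop_law_box i mB) _.
apply: etrans _ (esym (drop_law_box j mB)).
by apply: eq_bigr => l _; exact: idd.
Qed.

End IndependentRVs.

Lemma frob_norm_sqr (R : realType) m n (M : 'M[R]_(m, n)) :
  frob_norm M ^+ 2 = \sum_i \sum_j M i j ^+ 2.
Proof.
rewrite sqr_sqrtr//; apply: sumr_ge0 => i _; apply: sumr_ge0 => j _.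
exact: sqr_ge0.
Qed.

Lemma quad_form_quadratic (R : realType) n (M : 'M[R]_n) (x : n.-tuple R) :
  quad_form M (\col_i tnth x i) - \tr M = quadratic M (fun=> 0) 0 x.
Proof.
rewrite quad_form_sum /quadratic [X in _ = _ + X + _]big1 ?addr0 => [|i _]; last by rewrite mul0r.
by congr (_ - _); apply: eq_bigr => i _; apply: eq_bigr => j _; rewrite !mxE.
Qed.

Definition columns_mx (R : realType) n l (y : l.-tuple (n.-tuple R)) : 'M[R]_(n, l) :=
  \matrix_(a < n, b < l) tnth (tnth y b) a.

Lemma measurable_columns_mx (R : realType) d (T : measurableType d) n l
    (g : T -> l.-tuple (n.-tuple R)) :
  measurable_fun [set: T] g -> measurable_mx (fun w => columns_mx (g w)).
Proof.
move=> mg a b; rewrite (_ : (fun w => _) = (fun w => tnth (tnth (g w) b) a)).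
  apply: (measurableT_comp (measurable_tnth a)).
  exact: (measurableT_comp (measurable_tnth b)).
by apply/funext => w; rewrite mxE.
Qed.

(** * Integrating the error bound *)

Section FlexTrace.
Variables (R : realType) (n k : nat) (A : 'M[R]_n) (f : R -> R).
Hypotheses (pA : psdmx A) (hf : in_scrF f).
Context (d : measure_display) (T : measurableType d) (P : probability T R).
Variable omega : 'I_k.+1 -> {RV P >-> n.-tuple R}.
Hypotheses (hgauss : forall i, std_gaussian_vector (omega i)).
Hypothesis hindep : independent_RVs omega.

Let err (y : k.-tuple (n.-tuple R)) := nystrom_error f A (columns_mx y).

Let measurable_err d' (T' : measurableType d') (g : T' -> k.-tuple (n.-tuple R)) :
  measurable_fun [set: T'] g -> measurable_mx (fun w => err (g w)).
Proof.
move=> mg; apply: measurable_mxD; first exact: measurable_mx_cst.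
apply: measurable_mxN; apply: measurable_funmx_scrF => //.
  by move=> w; exact: psd_nystrom.
by apply: measurable_nystrom => //; exact: measurable_columns_mx.
Qed.

Let measurable_test_matrix : measurable_mx (test_matrix omega).
Proof.
move=> a b; rewrite (_ : (fun w => _) = (fun w => tnth (omega b w) a)).
  exact: (measurableT_comp (measurable_tnth a)).
by apply/funext => w; rewrite mxE.
Qed.

Let drop_test_matrix i w :
  col' i (test_matrix omega w) = columns_mx (drop_RV omega i w).
Proof. by apply/matrixP => a b; rewrite !mxE tnth_mktuple. Qed.

Let measurable_flextrace :
  measurable_fun [set: T] (fun w => flextrace f A (test_matrix omega w)).
Proof.
have mfdrop i : measurable_mx (fun w => funmx f (nystrom_drop A (test_matrix omega w) i)).
  apply: measurable_funmx_scrF => //; first by move=> w; exact: psd_nystrom.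
  apply: measurable_nystrom => //.
  under eq_fun do rewrite drop_test_matrix.
  exact/measurable_columns_mx/measurable_drop_RV.
have mfnys : measurable_mx (fun w => funmx f (nystrom A (test_matrix omega w))).
  apply: measurable_funmx_scrF => //; first by move=> w; exact: psd_nystrom.
  exact: measurable_nystrom.
apply: measurable_funM => //; apply: measurable_sum => i.
apply: measurable_funD; first exact: measurable_trace.
apply: measurable_quad_form.
  by apply: measurable_mxD => //; exact: measurable_mxN.
move=> a b; rewrite (_ : (fun w => _) = (fun w => test_matrix omega w a i)) //.
by apply/funext => w; rewrite [LHS]mxE.
Qed.

Let identically_distributed a b (B : set (n.-tuple R)) : measurable B ->
  distribution P (omega a) B = distribution P (omega b) B.
Proof.
apply: (@tuple_measure_unique _ _ _ _ (distribution P (omega a)) (distribution P (omega b))).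
  exact: le_lt_trans (probability_le1 (distribution P (omega a)) measurableT) (ltry 1).
move=> C mC; apply: etrans (hgauss a mC) _; exact: esym (hgauss b mC).
Qed.

(** The i-th summand of the error bound, as a function of the independent pair formed by w_i and the
    remaining columns. *)
Let G (z : n.-tuple R * k.-tuple (n.-tuple R)) : R :=
  quadratic (err z.2) (fun=> 0) 0 z.1 ^+ 2 + \tr (err z.2) ^+ 2.

Let measurable_G : measurable_fun [set: n.-tuple R * k.-tuple (n.-tuple R)] G.
Proof.
have merr : measurable_mx (fun z : n.-tuple R * k.-tuple (n.-tuple R) => err z.2).
  exact: (measurable_err measurable_snd).
apply: measurable_funD; last first.
  by apply: measurable_funX; exact: (measurable_trace merr).
apply: measurable_funX.
rewrite (_ : (fun z => _) = (fun z => quad_form (err z.2) (\col_i tnth z.1 i) - \tr (err z.2))).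
  apply: measurable_funB; last exact: (measurable_trace merr).
  apply: measurable_quad_form => // a b.
  rewrite (_ : (fun w => _) = (fun w => tnth w.1 a)).
    exact: (measurableT_comp (measurable_tnth a) measurable_fst).
  by apply/funext => w; rewrite mxE.
by apply/funext => z; rewrite quad_form_quadratic.
Qed.

(** What remains of [G] once its Gaussian first argument is integrated out. *)
Let Phi (y : k.-tuple (n.-tuple R)) : R :=
  2 * frob_norm (err y) ^+ 2 + nuclear_norm (err y) ^+ 2.

Let psd_err y : psdmx (err y).
Proof. exact: psd_nystrom_error. Qed.

Let measurable_frob d' (T' : measurableType d') (g : T' -> k.-tuple (n.-tuple R)) :
  measurable_fun [set: T'] g -> measurable_fun [set: T'] (fun w => frob_norm (err (g w)) ^+ 2).
Proof.
move=> mg; under eq_fun do rewrite frob_norm_sqr.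
apply: measurable_sum => i; apply: measurable_sum => j; apply: measurable_funX.
exact: measurable_err.
Qed.

Let measurable_nuclear d' (T' : measurableType d') (g : T' -> k.-tuple (n.-tuple R)) :
  measurable_fun [set: T'] g -> measurable_fun [set: T'] (fun w => nuclear_norm (err (g w)) ^+ 2).
Proof.
move=> mg; under eq_fun do rewrite nuclear_norm_psd//.
by apply: measurable_funX; apply: measurable_trace; exact: measurable_err.
Qed.

(** The index [i0] on the right does not vary with [i], so all summands get the same expectation. *)
Let integral_G i i0 :
  (\int[P]_w (G (omega i w, drop_RV omega i w))%:E
   = \int[P]_w (Phi (drop_RV omega i0 w))%:E)%E.
Proof.
rewrite (integral_independent hindep i (G := fun z => (G z)%:E)); last 2 first.
- exact/measurable_EFinP.
- by move=> z; rewrite lee_fin addr_ge0 ?sqr_ge0.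
transitivity (\int[drop_law omega i]_y (Phi y)%:E)%E.
  apply: eq_integral => y _; under eq_integral do rewrite EFinD.
  rewrite ge0_integralD//=; last 3 first.
  - by move=> x _; rewrite lee_fin sqr_ge0.
  - exact: measurable_quadratic_sqr.
  - by move=> x _; rewrite lee_fin sqr_ge0.
  rewrite integral_cst_probability gaussian_quadratic; last 2 first.
  - exact: hgauss.
  - by move=> a b; have [s _] := psd_err y; rewrite -[in LHS]s mxE.
  rewrite -EFinD /Phi frob_norm_sqr nuclear_norm_psd//.
  by rewrite [X in _ + X + _]big1 ?expr0n ?addr0// => a _; rewrite expr0n.
rewrite (eq_measure_integral (drop_law omega i0)) => [|B mB _]; last first.
  exact: (drop_law_unique hindep i i0 identically_distributed).
rewrite ge0_integral_distribution//.
- apply/measurable_EFinP; apply: measurable_funD; last exact: (measurable_nuclear (g := id)).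
  by apply: measurable_funM => //; exact: (measurable_frob (g := id)).
- move=> y; rewrite lee_fin; apply: addr_ge0; last exact: sqr_ge0.
  by rewrite mulr_ge0 // sqr_ge0.
Qed.

Lemma flextrace_MSE i0 :
  (MSE P (\tr (funmx f A)) (fun w => flextrace f A (test_matrix omega w)) <=
   \int[P]_w (Phi (drop_RV omega i0 w))%:E)%E.
Proof.
pose Gi i w := G (omega i w, drop_RV omega i w).
have mGi i : measurable_fun [set: T] (Gi i).
  apply: (measurableT_comp measurable_G); apply: measurable_fun_pair => //.
  exact: measurable_drop_RV.
have Gi0 i w : 0 <= Gi i w by rewrite addr_ge0 ?sqr_ge0.
apply: le_trans (_ : \int[P]_w (k.+1%:R^-1 * \sum_i Gi i w)%:E <= _)%E.
  rewrite /MSE unlock; apply: ge0_le_integral => //.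
  - by move=> w _; rewrite lee_fin sqr_ge0.
  - apply/measurable_EFinP; apply: measurable_funX; exact: measurable_funB.
  - apply/measurable_EFinP; apply: measurable_funM => //.
    by apply: measurable_sum.
  move=> w _; rewrite lee_fin; apply: le_trans (flextrace_error hf pA _ _) _ => //.
  rewrite ler_wpM2l ?invr_ge0//; apply: ler_sum => i _.
  rewrite /Gi /G /= drop_test_matrix -quad_form_quadratic -/(err _).
  by rewrite (_ : col i _ = \col_a tnth (omega i w) a)//; apply/colP => a; rewrite !mxE.
under eq_integral do rewrite EFinM -sumEFin.
rewrite ge0_integralZl//; last 2 first.
- by apply: emeasurable_sum => i; exact/measurable_EFinP.
- by move=> w _; apply: sume_ge0 => i _; rewrite lee_fin.
rewrite ge0_integral_sum//; last 2 first.
- by move=> i; exact/measurable_EFinP.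
- by move=> i w _; rewrite lee_fin.
under eq_bigr do rewrite (integral_G _ i0).
(* [C] could be +oo at this point, so the mean of k + 1 copies is computed in the extended reals. *)
set C := (\int[P]_w _)%E. have -> : (\sum_(i < k.+1) C = k.+1%:R%:E * C)%E.
  by rewrite big_const_ord mule_natl; exact: iter_addr_0.
by rewrite muleA -EFinM mulVf ?mul1e.
Qed.

Lemma flextrace_MSE_norms i0 :
  (MSE P (\tr (funmx f A)) (fun w => flextrace f A (test_matrix omega w))
   <= 2%:E * 'E_P[fun w => (frob_norm (nystrom_error f A (col' i0 (test_matrix omega w))) ^+ 2)%R]
      + 2%:E * 'E_P[fun w => (nuclear_norm (nystrom_error f A (col' i0 (test_matrix omega w))) ^+ 2)%R])%E.
Proof.
apply: le_trans (flextrace_MSE i0) _.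
have mdrop := measurable_drop_RV omega i0.
rewrite unlock; under [X in (_ <= 2%:E * X + _)%E]eq_integral do rewrite /= drop_test_matrix -/(err _).
under [X in (_ <= _ + 2%:E * X)%E]eq_integral do rewrite /= drop_test_matrix -/(err _).
rewrite /Phi; under [X in (X <= _)%E]eq_integral do rewrite EFinD EFinM.
have mF := measurable_frob mdrop; have mN := measurable_nuclear mdrop.
rewrite ge0_integralD//; last 4 first.
- by move=> w _; rewrite -EFinM lee_fin mulr_ge0 // sqr_ge0.
- by apply: emeasurable_funM => //; exact/measurable_EFinP.
- by move=> w _; rewrite lee_fin sqr_ge0.
- exact/measurable_EFinP.
rewrite ge0_integralZl//; last 2 first.
- exact/measurable_EFinP.
- by move=> w _; rewrite lee_fin sqr_ge0.
(* The coefficient 1 of the nuclear term is relaxed to 2 by adding a nonnegative copy. *)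
apply: leeD => //; rewrite mule_natl mule2n leeDl//.
by apply: integral_ge0 => w _; rewrite lee_fin sqr_ge0.
Qed.

End FlexTrace.

Theorem theorem3p5 (R : realType) (n k : nat) (hk : (0 < k)%N) (hkn : (k <= n)%N)
    (A : 'M[R]_n) (hA : psdmx A) (f : R -> R) (hf : in_scrF f)
    (d : measure_display) (T : measurableType d) (P : probability T R)
    (omega : 'I_k -> {RV P >-> n.-tuple R})
    (hgauss : forall i, std_gaussian_vector (omega i))
    (hindep : independent_RVs omega) :
  let Omega := test_matrix omega in
  let Err := fun w : T =>
    funmx f A - funmx f (nystrom_drop A (Omega w) (Ordinal hk)) in
  (MSE P (\tr (funmx f A)) (fun w => flextrace f A (Omega w))
   <= 2%:E * 'E_P[fun w => (frob_norm (Err w) ^+ 2)%R]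
      + 2%:E * 'E_P[fun w => (nuclear_norm (Err w) ^+ 2)%R])%E.
Proof.
case: k hk hkn omega hgauss hindep => [//|k] hk hkn omega hgauss hindep.
exact: flextrace_MSE_norms.
Qed.
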